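(* Fix $\rho\in(0,1/2)$, $\varepsilon\in(0,1/2)$, $\gamma\in(1/2+\varepsilon,1)$ and $\delta>0$. If $\Delta$ is large enough and $C_A$, $C_B$ are binary linear codes of length $\Delta$ such that 1. $0<\dim C_A\le\rho\Delta$ and $\dim C_B=\Delta-\dim C_A$, 2. the minimum distances of $C_A,C_B,C_A^\perp,C_B^\perp$ are all $\ge\delta\Delta$, 3. both dual tensor codes $(C_A\otimes C_B)^\perp=C_A^\perp\otimes\mathbb F_2^B+\mathbb F_2^A\otimes C_B^\perp$ and $(C_A^\perp\otimes C_B^\perp)^\perp=C_A\otimes\mathbb F_2^B+\mathbb F_2^A\otimes C_B$ are $\Delta^{3/2-\varepsilon/2}$-robust with $\Delta^\gamma$-resistance to puncturing, then for every left-right Cayley complex $X(G,A,B)$ with $|A|=|B|=\Delta$ that satisfies the Total No-Conjugacy condition and for which $\mathrm{Cay}(G,A)$ and $\mathrm{Cay}(G,B)$ are Ramanujan, the associated quantum code $\mathcal Q=(\mathcal C_0,\mathcal C_1)$ of length $n=|Q|$ has dimension $k$ and minimum distance $d$ satisfying $$k\ge(1-2\rho)^2n,\qquad d\ge\frac{\delta}{4\Delta^{3/2+\varepsilon}}\,n .$$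
   Context: **Left-right Cayley complex $X(G,A,B)$.** $G$ is a finite group and $A=A^{-1}$, $B=B^{-1}$ are subsets of $G$ with $|A|=|B|=\Delta$, satisfying the Total No-Conjugacy (TNC) condition: $ag\neq gb$ for all $a\in A$, $b\in B$, $g\in G$. Put $V_0=G\times\{0\}$, $V_1=G\times\{1\}$. The set $Q$ of squares is the set of all 4-subsets $\{(g,0),(ag,1),(gb,1),(agb,0)\}$ with $g\in G,a\in A,b\in B$; $|Q|=\Delta^2|G|/2$. For $v=(g,i)$, $Q(v)$ denotes the set of squares containing $v$. By TNC the map $(a,b)\mapsto\{(g,i),(ag,1-i),(gb,1-i),(agb,i)\}$ is a bijection $A\times B\to Q(v)$. For $x\in\mathbb F_2^Q$ the local view $x_v$ is the restriction of $x$ to $Q(v)$, viewed through this bijection as an element of $\mathbb F_2^{A\times B}$ (matrices with rows indexed by $A$, columns by $B$). **Codes.** Codes of length $\Delta$ are viewed as subspaces $C_A\subset\mathbb F_2^A$, $C_B\subset\mathbb F_2^B$ through fixed bijections of $A$ and $B$ with $\{1,\dots,\Delta\}$. $C_A\otimes C_B$ is the space of $A\times B$ matrices with all columns in $C_A$ and all rows in $C_B$; $C_A\otimes\mathbb F_2^B$ is the space of matrices with all columns in $C_A$, $\mathbb F_2^A\otimes C_B$ that of matrices with all rows in $C_B$. Put $C_0=C_A\otimes C_B$, $C_1=C_A^\perp\otimes C_B^\perp$. **Quantum code.** $\mathcal C_0=\{x\in\mathbb F_2^Q: x_v\in C_0^\perp\ \forall v\in V_0\}$, $\mathcal C_1=\{x\in\mathbb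 F_2^Q: x_v\in C_1^\perp\ \forall v\in V_1\}$. One has $\mathcal C_0^\perp\subset\mathcal C_1$, and $\mathcal Q=(\mathcal C_0,\mathcal C_1)$ is the corresponding quantum CSS code: length $n=|Q|$, dimension $k=\dim\mathcal C_0+\dim\mathcal C_1-n$, minimum distance $d$ equal to the smallest Hamming weight of a vector in $(\mathcal C_0\setminus\mathcal C_1^\perp)\cup(\mathcal C_1\setminus\mathcal C_0^\perp)$. **Robustness.** For codes $D_A\subset\mathbb F_2^A$, $D_B\subset\mathbb F_2^B$ with minimum distances $d_A,d_B$, the dual tensor code $D_A\otimes\mathbb F_2^B+\mathbb F_2^A\otimes D_B$ is $w$-robust if for every codeword $x$ in it with Hamming weight $|x|\le w$ there exist $A'\subset A$, $B'\subset B$ with $|A'|\le|x|/d_B$, $|B'|\le|x|/d_A$ such that $x_{ab}=0$ whenever $a\notin A'$ and $b\notin B'$. For $A'\subset A$, $D_{A'}\subset\mathbb F_2^{A'}$ is the punctured code of restrictions to $A'$ of codewords of $D_A$; similarly $D_{B'}$. The dual tensor code is $w$-robust with $p$-resistance to puncturing if for all $A'\subset A$, $B'\subset B$ with $|A'|=|B'|=\Delta-w'$, $w'\le p$, the dual tensor code $D_{A'}\otimes\mathbb F_2^{B'}+\mathbb F_2^{A'}\otimes D_{B'}$ is $w$-robust (with respect to the minimum distances of $D_{A'},D_{B'}$). **Ramanujan.** $\mathrm{Cay}(G,A)$ has edges $\{g,ag\}$, $\mathrm{Cay}(G,B)$ has edges $\{g,gb\}$. Here these are required to be connected and non-bipartite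 with every eigenvalue other than $\Delta$ of absolute value at most $2\sqrt{\Delta-1}$. *)

(* Defs.v *)
From HB Require Import structures.
From mathcomp Require Import all_boot all_order all_fingroup all_algebra.
From mathcomp Require Import reals exp.

Set Implicit Arguments.
Unset Strict Implicit.
Unset Printing Implicit Defensive.

Import Order.TTheory GRing.Theory Num.Theory.
Local Open Scope ring_scope.

(* 'F_2 must be seen as a module over itself for {ffun I -> 'F_2} to carry
   the library's structure of finite-dimensional vector space. *)
Notation F2 := ('F_2)^o.
Notation word I := {ffun I -> F2}.
Notation code I := {vspace word I}.

Section Words.
Variable I : finType.
Implicit Types (x y : word I) (C D : code I).

Definition wt x : nat := #|[set i | x i != 0]|.

(* The value on an empty predicate is #|I|.+1, which exceeds every weight. *)
Definition min_weight (P : pred (word I)) : nat :=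
  \big[minn/#|I|.+1]_(x : word I | P x) wt x.

Definition min_dist C : nat := min_weight [pred x | (x \in C) && (x != 0)].

Definition dotp x y : 'F_2 := \sum_i x i * y i.

Fact dotp_is_bilinear : bilinear_for *%R *%R dotp.
Proof.
split=> [u|u] a x y /=; rewrite /dotp [X in _ = X + _]mulr_sumr -big_split /=;
  apply: eq_bigr => i _; rewrite !ffunE /GRing.scale /=.
- by rewrite mulrDl mulrA.
- by rewrite mulrDr mulrCA.
Qed.

HB.instance Definition _ := bilinear_isBilinear.Build 'F_2 (word I) (word I)
  'F_2 *%R *%R dotp dotp_is_bilinear.

Fact dotp_sym x y : dotp x y = (-1) ^+ false * dotp y x.
Proof. by rewrite mul1r; apply: eq_bigr => i _; rewrite mulrC. Qed.

HB.instance Definition _ := isHermitianSesquilinear.Build 'F_2 (word I)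
  false idfun dotp dotp_sym.

Definition dual C : code I := orthov (dotp : {symmetric (word I)}) C.

(* Dimension and minimum distance of the quantum CSS code (C, D), where
   dual C is contained in D. *)
Definition css_dim C D : int := (\dim C)%:Z + (\dim D)%:Z - #|I|%:Z.

Definition css_dist C D : nat := min_weight
  [pred x | ((x \in C) && (x \notin dual D)) || ((x \in D) && (x \notin dual C))].

Definition restrict_word (A : {set I}) x : word {i | i \in A} :=
  [ffun i => x (val i)].

Fact restrict_is_linear A : linear (restrict_word A).
Proof. by move=> a x y; apply/ffunP=> i; rewrite !ffunE. Qed.

HB.instance Definition _ (A : {set I}) := GRing.isLinear.Build 'F_2 (word I)
  (word {i | i \in A}) *:%R (restrict_word A) (restrict_is_linear A).

Definition puncture (A : {set I}) C : code {i | i \in A} :=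
  (linfun (restrict_word A) @: C)%VS.

End Words.

Section TensorCodes.
Variables I J : finType.
Implicit Types (x : word (I * J)) (C : code I) (D : code J).

(* A matrix with rows indexed by I and columns by J is a word on I * J. *)
Definition col_word (j : J) x : word I := [ffun i => x (i, j)].
Definition row_word (i : I) x : word J := [ffun j => x (i, j)].

Fact col_word_is_linear j : linear (col_word j).
Proof. by move=> a x y; apply/ffunP=> i; rewrite !ffunE. Qed.
HB.instance Definition _ j := GRing.isLinear.Build 'F_2 (word (I * J))
  (word I) *:%R (col_word j) (col_word_is_linear j).

Fact row_word_is_linear i : linear (row_word i).
Proof. by move=> a x y; apply/ffunP=> j; rewrite !ffunE. Qed.
HB.instance Definition _ i := GRing.isLinear.Build 'F_2 (word (I * J))
  (word J) *:%R (row_word i) (row_word_is_linear i).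

(* C (x) F_2^J *)
Definition cols_in C : code (I * J) :=
  (\bigcap_(j : J) (linfun (col_word j) @^-1: C))%VS.

(* F_2^I (x) D *)
Definition rows_in D : code (I * J) :=
  (\bigcap_(i : I) (linfun (row_word i) @^-1: D))%VS.

Definition tensor C D : code (I * J) := (cols_in C :&: rows_in D)%VS.

Definition dual_tensor C D : code (I * J) := (cols_in C + rows_in D)%VS.

Definition robust (R : realType) (w : R) C D : Prop :=
  forall x, x \in dual_tensor C D -> (wt x)%:R <= w ->
  exists A' : {set I}, exists B' : {set J},
    [/\ #|A'|%:R <= (wt x)%:R / (min_dist D)%:R :> R,
        #|B'|%:R <= (wt x)%:R / (min_dist C)%:R :> R &
        forall i j, i \notin A' -> j \notin B' -> x (i, j) = 0].

End TensorCodes.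

Definition robust_punct (R : realType) (w p : R) (I J : finType)
    (C : code I) (D : code J) : Prop :=
  forall (w' : nat) (A' : {set I}) (B' : {set J}),
    w'%:R <= p -> (#|A'| + w' = #|I|)%N -> (#|B'| + w' = #|J|)%N ->
  robust w (puncture A' C) (puncture B' D).

Section Graphs.
Variable T : finType.
Implicit Type e : rel T.

Definition adjacency (R : realType) e : 'M[R]_#|T| :=
  \matrix_(i, j) (e (enum_val i) (enum_val j))%:R.

Definition connected_graph e : Prop := forall x y, connect e x y.

Definition bipartite e : Prop :=
  exists c : T -> bool, forall x y, e x y -> c x != c y.

(* e is a Delta-regular graph. *)
Definition Ramanujan (R : realType) (Delta : nat) e : Prop :=
  [/\ connected_graph e, ~ bipartite e &
      forall l : R, eigenvalue (adjacency R e) l -> l != Delta%:R ->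
        `|l| <= 2 * Num.sqrt (Delta%:R - 1)].

End Graphs.

Section LeftRightCayley.
Variable gT : finGroupType.
Implicit Types A B : {set gT}.

Definition Cay_left A : rel gT := fun g h => [exists a in A, h == (a * g)%g].
Definition Cay_right B : rel gT := fun g h => [exists b in B, h == (g * b)%g].

Definition TNC A B : Prop :=
  forall a b g : gT, a \in A -> b \in B -> (a * g <> g * b)%g.

(* Vertices are pairs (g, i), with false for 0 and true for 1. *)
Definition square (v : gT * bool) (a b : gT) : {set gT * bool} :=
  [set v; ((a * v.1)%g, ~~ v.2); ((v.1 * b)%g, ~~ v.2); ((a * v.1 * b)%g, v.2)].

Definition squares A B : {set {set gT * bool}} :=
  [set q | [exists g, exists a in A, exists b in B, q == square (g, false) a b]].

Definition sq A B := {q | q \in squares A B}.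

Section QuantumCode.
Variables (A B : {set gT}) (n : nat) (alpha beta : 'I_n -> gT).

(* alpha and beta are the bijections of 'I_n with A and B through which codes
   of length n are read on A and B. Under A^-1 = A every square v (alpha i)
   (beta j) lies in squares A B, so the default value 0 is never used. *)
Definition local_view (v : gT * bool) (x : word (sq A B)) :
    word ('I_n * 'I_n) :=
  [ffun ij => oapp x 0 (insub (square v (alpha ij.1) (beta ij.2)))].

Fact local_view_is_linear v : linear (local_view v).
Proof.
move=> a x y; apply/ffunP=> ij; rewrite !ffunE.
by case: insub => [s|] /=; rewrite ?ffunE // scaler0 addr0.
Qed.
HB.instance Definition _ v := GRing.isLinear.Build 'F_2 (word (sq A B))
  (word ('I_n * 'I_n)) *:%R (local_view v) (local_view_is_linear v).

(* The words whose local views at all vertices of type i lie in K. *)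
Definition Tanner (i : bool) (K : code ('I_n * 'I_n)) : code (sq A B) :=
  (\bigcap_(g : gT) (linfun (local_view (g, i)) @^-1: K))%VS.

Definition code0 (CA CB : code 'I_n) : code (sq A B) :=
  Tanner false (dual (tensor CA CB)).

Definition code1 (CA CB : code 'I_n) : code (sq A B) :=
  Tanner true (dual (tensor (dual CA) (dual CB))).

End QuantumCode.
End LeftRightCayley.

(* Main.v *)
(* Dimension: each of the 2|G| local constraint spaces has dimension at most
   dim CA * dim CB, and n = Delta^2 |G| / 2.

   Distance: let x be a nonzero codeword whose local views at one side V_i lie
   in the dual tensor code, and let S be the set of vertices of V_i with nonzero
   view. If |x| is below the bound then S is small, and expander mixing in the
   graph of the diagonals of the squares shows that few vertices of S are
   exceptional, i.e. have a view too heavy for robustness to apply. By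
   robustness a non-exceptional view is the sum of a few columns in one code and
   a few rows in the other, so it has a heavy line. Such a line is shared with a
   vertex of the opposite side; mixing in the Cayley graphs shows that the set T
   of those vertices has size O(|S| / Delta), so some g in T sees order of Delta
   heavy lines and at most Delta^(1/2 + eps) exceptional neighbours. Almost all
   rows and columns of the view at g are then close to codewords; robustness of
   the punctured codes makes these agree with a single tensor codeword, which
   differs from the view in o(Delta^2) places, whereas the view itself has weight
   of order Delta^2. Adding that tensor codeword, which lies in the dual of the
   other Tanner code, decreases the weight of x; iterating shows that x is in
   this dual. *)
Require Import Defs.
From HB Require Import structures.
From mathcomp Require Import all_boot all_order all_fingroup all_algebra.
From mathcomp Require Import reals exp.
From mathcomp Require Import complex zify ring lra.

Set Implicit Arguments.
Unset Strict Implicit.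
Unset Printing Implicit Defensive.

Import Order.TTheory GRing.Theory Num.Theory.
Local Open Scope ring_scope.

(** * Linear codes and tensor codes *)

Section Codimension.
Variables (F : fieldType) (vT : vectType F).

Lemma dimv_cap_ge (U V : {vspace vT}) :
  (\dim U + \dim V <= \dim (U :&: V) + \dim {:vT})%N.
Proof. by rewrite -dimv_sum_cap addnC leq_add2l dimvS ?subvf. Qed.

Lemma dimv_bigcap_ge (I : finType) (V : I -> {vspace vT}) (c : nat) :
  (forall i, \dim {:vT} <= \dim (V i) + c)%N ->
  (\dim {:vT} <= \dim (\bigcap_i V i)%VS + #|I| * c)%N.
Proof.
move=> hV; rewrite cardE -big_enum; elim: (enum I) => [|i s IHs].
  by rewrite big_nil addn0.
rewrite big_cons /= mulSn.
have := dimv_cap_ge (V i) (\bigcap_(j <- s) V j)%VS.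
have := hV i; move: IHs; rewrite /=. lia.
Qed.

End Codimension.

(** Rank-nullity on [f @^-1: K], whose kernel is all of [lker f] and whose image is [K] cut by the
    image of [f]. *)
Lemma dim_preim_ge (F : fieldType) (vT wT : vectType F) (f : 'Hom(vT, wT)) (K : {vspace wT}) :
  (\dim {:vT} + \dim K <= \dim (f @^-1: K) + \dim {:wT})%N.
Proof.
have <- := limg_ker_dim f (f @^-1: K)%VS.
have -> : (f @^-1: K :&: lker f)%VS = lker f.
  by apply/capv_idPr/subvP=> v; rewrite memv_ker -memv_preim => /eqP ->; rewrite mem0v.
have -> : (f @: (f @^-1: K))%VS = (K :&: limg f)%VS.
  apply/vspaceP => w; rewrite memv_cap; apply/memv_imgP/andP.
    by case=> v; rewrite -memv_preim => Kv ->; rewrite Kv memv_img ?memvf.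
  by case=> Kw /memv_imgP[v _ wE]; exists v; rewrite // -memv_preim -wE.
have := dimv_cap_ge K (limg f); have := limg_ker_dim f fullv; rewrite capfv; lia.
Qed.

(** * Duality for binary codes *)

Section DualCode.
Variable I : finType.
Implicit Types (x y : word I) (C D : code I).

Lemma dim_word : \dim {:word I} = #|I|.
Proof. by rewrite dimvf /dim /= muln1. Qed.

Lemma dotpC x y : dotp x y = dotp y x.
Proof. by rewrite dotp_sym mul1r. Qed.

Lemma mem_dualP C x : reflect {in C, forall y, dotp x y = 0} (x \in dual C).
Proof. exact: (@mem_orthovP _ _ _ _ (@dotp I : {symmetric (word I)}) C x). Qed.

Definition unit_word (i : I) : word I := [ffun j => (j == i)%:R].

Lemma word_sum_unit x : x = \sum_i (x i : 'F_2) *: unit_word i.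
Proof.
apply/ffunP => j; rewrite sum_ffunE (bigD1 j) //= !ffunE eqxx /GRing.scale /= mulr1.
by rewrite big1 ?addr0 // => i /negPf ij; rewrite !ffunE eq_sym ij /GRing.scale /= mulr0.
Qed.

Lemma dotp_linear_form (f : {linear word I -> F2}) x :
  dotp x [ffun i => f (unit_word i)] = f x.
Proof.
rewrite {2}[x]word_sum_unit linear_sum; apply: eq_bigr => i _.
by rewrite ffunE linearZ.
Qed.

(** A word [x] outside [C] is separated from it by a coordinate of [y - projv C y]: this linear form
    vanishes on [C] but not at [x], and [dotp_linear_form] realises it by a word, which then lies in
    [dual C]. *)
Lemma dualK C : dual (dual C) = C.
Proof.
apply/eqP; rewrite eqEsubv; apply/andP; split; apply/subvP => x; last first.
  by move=> Cx; apply/mem_dualP => y /mem_dualP hy; rewrite dotpC hy.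
apply: contraLR => NCx; apply/negP => /mem_dualP hx.
pose p y : word I := y - projv C y.
have [i xi] : exists i, p x i != 0.
  apply/existsP; apply: contraNT NCx; rewrite negb_exists => /forallP px0.
  have -> : x = projv C x; last exact: memv_proj.
  apply/eqP; rewrite -subr_eq0; apply/eqP/ffunP => i; rewrite [RHS]ffunE.
  by have := px0 i; rewrite negbK => /eqP.
have lin_f : linear (fun y => p y i : F2).
  by move=> a y z; rewrite /p linearP !ffunE /= scalerBr opprD addrACA.
pose f : {linear word I -> F2} := HB.pack (fun y => p y i : F2)
  (GRing.isLinear.Build _ _ _ _ (fun y => p y i : F2) lin_f).
move: xi; rewrite -[p x i]/(f x) -dotp_linear_form hx ?eqxx //.
apply/mem_dualP => y Cy; rewrite dotpC dotp_linear_form /= /p projv_id //.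
by rewrite subrr ffunE.
Qed.

Lemma dim_dual_ge C : (#|I| <= \dim (dual C) + \dim C)%N.
Proof.
(* [dual C] unfolds to an intersection of [\dim C] kernels of linear forms, each of codimension at
   most 1. *)
rewrite -dim_word -[\dim C in X in (_ + X)%N]card_ord -[X in (_ + X)%N]muln1.
apply: dimv_bigcap_ge => k.
rewrite -lpreim0; set f := linfun _.
have := dim_preim_ge f 0%VS.
by rewrite dimv0 addn0 [\dim {: F2}]dimvf.
Qed.

(** The duals of [C] and of its complement meet in 0, because every unit word splits along the two.
    So their dimensions add up to at most [#|I|], while [dim_dual_ge] bounds each from below. *)
Lemma dim_dual C : \dim (dual C) = (#|I| - \dim C)%N.
Proof.
have dis : (dual C :&: dual C^C)%VS = 0%VS.
  apply/eqP; rewrite -subv0; apply/subvP => x; rewrite memv_cap memv0.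
  case/andP => /mem_dualP xC /mem_dualP xCC; apply/eqP/ffunP => i.
  have /memv_addP[y Cy [z CCz yz]] : unit_word i \in (C + C^C)%VS.
    by rewrite addv_complf memvf.
  have : dotp x (unit_word i) = 0.
    rewrite yz linearDr; move: (xC _ Cy) (xCC _ CCz).
    by rewrite /= => -> ->; rewrite addr0.
  rewrite /dotp (bigD1 i) //= !ffunE eqxx mulr1 big1 ?addr0 // => j /negPf ji.
  by rewrite !ffunE ji mulr0.
have := dimv_sum_cap (dual C) (dual C^C); rewrite dis dimv0 addn0.
have : (\dim (dual C + dual C^C) <= #|I|)%N by rewrite -dim_word dimvS ?subvf.
have := dim_dual_ge C; have := dim_dual_ge C^C%VS.
rewrite dimv_compl dim_word; have : (\dim C <= #|I|)%N.
  by rewrite -dim_word dimvS ?subvf.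
move: (\dim C) (\dim (dual C)) (\dim (dual C^C)) => a b c; lia.
Qed.

End DualCode.

(** * Hamming weight and erasure decoding *)

Section Weight.
Variable I : finType.
Implicit Types (x y : word I) (C : code I).

Lemma word_addxx x : x + x = 0.
Proof. by apply/ffunP => i; rewrite !ffunE; apply: addrr_pchar2. Qed.

Lemma wt_sum x : wt x = (\sum_i (x i != 0%R))%N.
Proof. by rewrite /wt -sum1dep_card big_mkcond; apply: eq_bigr => i _; case: (x i != 0). Qed.

Lemma wt_eq0 x : (wt x == 0) = (x == 0).
Proof.
rewrite cards_eq0; apply/eqP/eqP => [e|->]; last by apply/setP => i; rewrite !inE ffunE eqxx.
by apply/ffunP => i; rewrite ffunE; apply/eqP; have := in_set0 i; rewrite -e inE => /negbFE.
Qed.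

Lemma wt_leq_card x (S : {set I}) : (forall i, i \notin S -> x i = 0) -> (wt x <= #|S|)%N.
Proof.
move=> h; apply/subset_leq_card/subsetP => i; rewrite inE; apply: contraNT.
by move/h/eqP.
Qed.

Lemma leq_wtD x y : (wt (x + y)%R <= wt x + wt y)%N.
Proof.
rewrite !wt_sum -big_split leq_sum // => i _; rewrite ffunE.
by have [->|_] := eqVneq (x i) 0; rewrite ?add0r //=; case: (_ != 0).
Qed.

Lemma min_weight_le (P : pred (word I)) x : P x -> (min_weight P <= wt x)%N.
Proof.
rewrite /min_weight => Px; have := mem_index_enum x.
elim: (index_enum _) => // y s IHs; rewrite inE big_cons => /predU1P[<-|/IHs le].
  by rewrite Px geq_minl.
by case: (P y) => //; apply: leq_trans (geq_minr _ _) le.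
Qed.

Lemma min_weight_ge (P : pred (word I)) m :
  (m <= #|I|.+1)%N -> (forall x, P x -> (m <= wt x)%N) -> (m <= min_weight P)%N.
Proof.
move=> mI h; rewrite /min_weight; elim/big_ind: _ => // a b ma mb.
by rewrite leq_min ma.
Qed.

Lemma min_dist_le C x : x \in C -> x != 0 -> (min_dist C <= wt x)%N.
Proof. by move=> Cx x0; apply: min_weight_le; rewrite inE Cx. Qed.

Lemma min_dist_leS C : (min_dist C <= #|I|.+1)%N.
Proof.
rewrite /min_dist /min_weight; elim/big_ind: _ => // [a b ma _|x _].
  by rewrite geq_min ma.
exact: leqW (max_card _).
Qed.

Lemma eq0_wt_lt C x : x \in C -> (wt x < min_dist C)%N -> x = 0.
Proof.
move=> Cx; apply: contraTeq => x0.
by rewrite -leqNgt min_dist_le.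
Qed.

Definition mask (S : {set I}) x : word I := [ffun i => if i \in S then 0 else x i].

Fact mask_is_linear S : linear (mask S).
Proof.
move=> a x y; apply/ffunP=> i; rewrite !ffunE.
by case: (i \in S); rewrite ?scaler0 ?addr0.
Qed.

HB.instance Definition _ S := GRing.isLinear.Build 'F_2 (word I) (word I) *:%R
  (mask S) (mask_is_linear S).

(* A code of minimum distance greater than #|S| corrects erasures on S, and it
   does so linearly. *)
Lemma erasure_recovery C (S : {set I}) : (#|S| < min_dist C)%N ->
  exists2 E : 'End(word I), forall y, E y \in C &
    forall y c, c \in C -> (forall i, i \notin S -> y i = c i) -> E y = c.
Proof.
move=> SC; pose f := linfun (mask S); pose g := (f \o projv C)%VF.
have gE v : g v = f (projv C v) by rewrite comp_lfunE.
exists (projv C \o (g^-1 \o f))%VF => [y|y c Cc yc].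
  by rewrite comp_lfunE memv_proj.
(* Erasing [S] is injective on [C], as a codeword supported on [S] is too light; hence the
   pseudo-inverse of [g] determines the codeword. *)
have fC d : d \in C -> f d = 0 -> d = 0.
  move=> Cd; rewrite lfunE => /ffunP fd0; apply: (eq0_wt_lt Cd).
  apply: leq_ltn_trans SC; apply: wt_leq_card => i /negPf Si.
  by have := fd0 i; rewrite !ffunE Si.
rewrite !comp_lfunE.
have -> : f y = g c.
  rewrite gE projv_id // !lfunE /=; apply/ffunP => i; rewrite !ffunE.
  by case: ifPn => // /yc.
apply/eqP; rewrite -subr_eq0; apply/eqP/fC; first by rewrite memvB ?memv_proj.
rewrite linearB /=; apply/eqP; rewrite subr_eq0; apply/eqP.
have : g (g^-1%VF (g c)) = g c by rewrite limg_lfunVK ?memv_img ?memvf.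
by rewrite !gE (projv_id Cc).
Qed.

End Weight.

(** * Tensor codes and dual tensor codes *)

Section Tensor.
Variables I J : finType.
Implicit Types (x : word (I * J)) (C : code I) (D : code J).

Lemma dotp_prod x y : dotp x y = \sum_i \sum_j x (i, j) * y (i, j).
Proof. by rewrite pair_bigA; apply: eq_bigr => -[]. Qed.

Lemma wt_rows x : wt x = (\sum_k wt (row_word k x))%N.
Proof.
rewrite wt_sum (eq_bigr (fun kl => (x (kl.1, kl.2) != 0%R) : nat)); last by case.
rewrite -(pair_bigA _ (fun k l => (x (k, l) != 0%R) : nat)).
by apply: eq_bigr => k _; rewrite wt_sum; apply: eq_bigr => l _; rewrite ffunE.
Qed.

Lemma wt_cols x : wt x = (\sum_l wt (col_word l x))%N.
Proof.
rewrite wt_sum (eq_bigr (fun kl => (x (kl.1, kl.2) != 0%R) : nat)); last by case.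
rewrite -(pair_bigA _ (fun k l => (x (k, l) != 0%R) : nat)) exchange_big.
by apply: eq_bigr => k _; rewrite wt_sum; apply: eq_bigr => l _; rewrite ffunE.
Qed.

Lemma mem_cols_inP C x : reflect (forall j, col_word j x \in C) (x \in cols_in J C).
Proof.
apply: (iffP subv_bigcapP) => [h j|h j _].
  by have := h j isT; rewrite -memvE -memv_preim lfunE.
by rewrite -memvE -memv_preim lfunE /=.
Qed.

Lemma mem_rows_inP D x : reflect (forall i, row_word i x \in D) (x \in rows_in I D).
Proof.
apply: (iffP subv_bigcapP) => [h i|h i _].
  by have := h i isT; rewrite -memvE -memv_preim lfunE.
by rewrite -memvE -memv_preim lfunE /=.
Qed.

(** Applying [E] to every row is a right multiplication by a matrix, so each new column is a linear
    combination of old columns. *)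
Lemma rowwise_cols_in C (E : 'End(word J)) x : x \in cols_in J C ->
  [ffun ij : I * J => E (row_word ij.1 x) ij.2] \in cols_in J C.
Proof.
move=> /mem_cols_inP xC; apply/mem_cols_inP => j.
have -> : col_word j [ffun ij : I * J => E (row_word ij.1 x) ij.2] =
    \sum_j' (E (unit_word j') j : 'F_2) *: col_word j' x.
  apply/ffunP => i; rewrite !ffunE /= [row_word i x]word_sum_unit linear_sum /=.
  rewrite !sum_ffunE; apply: eq_bigr => j' _; rewrite linearZ !ffunE /GRing.scale /=.
  by rewrite mulrC.
by apply: memv_suml => j' _; rewrite memvZ.
Qed.

(** Decode the erasures in [B] on every row of [c]. Rows outside [A] become those of [r], and
    columns stay in [C] by linearity of the decoder. A column outside [B] then agrees with that of
    [c] off [A], hence everywhere by the distance of [C]. *)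
Lemma tensor_split C D c r (A : {set I}) (B : {set J}) :
    c \in cols_in J C -> r \in rows_in I D ->
    (forall i j, i \notin A -> j \notin B -> c (i, j) = r (i, j)) ->
    (#|A| < min_dist C)%N -> (#|B| < min_dist D)%N ->
  exists t, [/\ t \in tensor C D,
    forall i j, i \notin A -> t (i, j) = r (i, j) &
    forall i j, j \notin B -> t (i, j) = c (i, j)].
Proof.
move=> cC rD cr AC BD; have [E ED Erec] := erasure_recovery BD.
pose t : word (I * J) := [ffun ij => E (row_word ij.1 c) ij.2].
have tC : t \in cols_in J C by apply: rowwise_cols_in.
have tr i j : i \notin A -> t (i, j) = r (i, j).
  move=> Ai; rewrite ffunE /= (Erec _ (row_word i r)) ?ffunE //.
    by move/mem_rows_inP: rD; apply.
  by move=> k Bk; rewrite !ffunE cr.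
exists t; split=> //.
  rewrite memv_cap tC; apply/mem_rows_inP => i.
  have -> : row_word i t = E (row_word i c) by apply/ffunP => j; rewrite !ffunE.
  exact: ED.
move=> i j Bj; suff /ffunP/(_ i) : col_word j (t - c) = 0.
  by rewrite !ffunE => /eqP; rewrite subr_eq0 => /eqP.
apply: (@eq0_wt_lt _ C); first by move: (memvB tC cC) => /mem_cols_inP.
apply: leq_ltn_trans AC; apply: wt_leq_card => k Ak.
rewrite [LHS]ffunE [LHS]ffunE tr //.
by rewrite -cr // ffunE subrr.
Qed.

Lemma mem_dual_tensorP C D x :
  reflect (exists c r, [/\ c \in cols_in J C, r \in rows_in I D & x = c + r])
    (x \in dual_tensor C D).
Proof.
apply: (iffP memv_addP) => [[c cC [r rD ->]]|[c [r [cC rD ->]]]].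
  by exists c, r.
by exists c => //; exists r.
Qed.

Lemma dual_subv (K : finType) (U V : code K) : (U <= V)%VS -> (dual V <= dual U)%VS.
Proof.
move=> /subvP UV; apply/subvP => x /mem_dualP xV; apply/mem_dualP => y Uy.
by apply: xV; apply: UV.
Qed.

(** By [dualK] it suffices that a word orthogonal to the dual tensor code has columns in [dual C]
    and rows in [dual D]; this is tested on matrices supported on a single column or row. *)
Lemma dual_tensor_dual C D : (dual (tensor (dual C) (dual D)) <= dual_tensor C D)%VS.
Proof.
rewrite -[dual_tensor C D]dualK; apply: dual_subv; apply/subvP => x /mem_dualP xCD.
rewrite memv_cap; apply/andP; split.
  apply/mem_cols_inP => j; apply/mem_dualP => c Cc.
  pose y : word (I * J) := [ffun ij => if ij.2 == j then c ij.1 else 0].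
  have yC : y \in dual_tensor C D.
    apply/mem_dual_tensorP; exists y, 0; split; rewrite ?addr0 ?mem0v //.
    apply/mem_cols_inP => k; have [<-|jk] := eqVneq j k.
      by have -> : col_word j y = c by apply/ffunP => i; rewrite !ffunE eqxx.
    have -> : col_word k y = 0 by apply/ffunP => i; rewrite !ffunE /= eq_sym (negPf jk).
    exact: mem0v.
  rewrite -[RHS](xCD _ yC) dotp_prod.
  apply: eq_bigr => i _; rewrite (bigD1 j) //= big1 ?addr0 ?ffunE ?eqxx //=.
  by move=> k /negPf kj; rewrite ffunE /= kj mulr0.
apply/mem_rows_inP => i; apply/mem_dualP => d Dd.
pose y : word (I * J) := [ffun ij => if ij.1 == i then d ij.2 else 0].
have yD : y \in dual_tensor C D.
  apply/mem_dual_tensorP; exists 0, y; split; rewrite ?add0r ?mem0v //.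
  apply/mem_rows_inP => k; have [<-|jk] := eqVneq i k.
    by have -> : row_word i y = d by apply/ffunP => j; rewrite !ffunE eqxx.
  have -> : row_word k y = 0 by apply/ffunP => j; rewrite !ffunE /= eq_sym (negPf jk).
  exact: mem0v.
rewrite -[RHS](xCD _ yD) dotp_prod.
rewrite (bigD1 i) //= [X in _ + X]big1 ?addr0; last first.
  by move=> k /negPf ki; rewrite big1 // => j _; rewrite ffunE /= ki mulr0.
by apply: eq_bigr => j _; rewrite !ffunE /= eqxx.
Qed.

(** Products of basis words span the tensor code: expand the columns in the basis of [C]; the
    coefficient rows [M k] are combinations of rows of [t], hence lie in [D] and can be expanded in
    turn. *)
Lemma dim_tensor C D : (\dim (tensor C D) <= \dim C * \dim D)%N.
Proof.
pose P (c : word I) (d : word J) : word (I * J) := [ffun ij => (c ij.1 : 'F_2) * d ij.2].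
pose X := [seq P c d | c <- vbasis C, d <- vbasis D].
have <- : size X = (\dim C * \dim D)%N by rewrite size_allpairs !size_tuple.
apply: leq_trans (dim_span X); apply: dimvS; apply/subvP => t.
rewrite memv_cap => /andP[/mem_cols_inP tC /mem_rows_inP tD].
pose M k : word J := \sum_i (coord (vbasis C) k (unit_word i) : 'F_2) *: row_word i t.
have MD k : M k \in D by apply: memv_suml => i _; rewrite memvZ.
have ME k j : M k j = coord (vbasis C) k (col_word j t).
  rewrite [col_word j t]word_sum_unit linear_sum sum_ffunE; apply: eq_bigr => i _.
  by rewrite linearZ !ffunE /GRing.scale /= mulrC.
have -> : t = \sum_k \sum_l 
    (coord (vbasis D) l (M k) : 'F_2) *: P (vbasis C)`_k (vbasis D)`_l.
  apply/ffunP => -[i j]; have -> : t (i, j) = col_word j t i by rewrite ffunE.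
  rewrite (coord_vbasis (tC j)) !sum_ffunE; apply: eq_bigr => k _.
  rewrite ffunE -ME [in LHS](coord_vbasis (MD k)) !sum_ffunE /GRing.scale /= mulr_suml.
  by apply: eq_bigr => l _; rewrite !ffunE /GRing.scale /= mulrAC mulrA.
apply: memv_suml => k _; apply: memv_suml => l _; apply: memvZ; apply: memv_span.
by apply: allpairs_f; rewrite mem_nth ?size_tuple.
Qed.

End Tensor.

(** Pads a set to a prescribed size, since resistance to puncturing removes equally many rows and
    columns. *)
Lemma set_enlarge (I : finType) (A : {set I}) e :
  (#|A| <= e <= #|I|)%N -> exists2 A1 : {set I}, A \subset A1 & #|A1| = e.
Proof.
case/andP => Ae eI; pose s := take (e - #|A|) (enum (~: A)).
have us : uniq s by rewrite take_uniq ?enum_uniq.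
exists (A :|: [set i in s]); first exact: subsetUl.
rewrite cardsU (_ : A :&: _ = set0); last first.
  apply/setP => i; rewrite !inE; apply/andP => -[Ai /mem_take].
  by rewrite mem_enum inE Ai.
rewrite cards0 subn0 cardsE (card_uniqP us) size_takel ?subnKC //.
by rewrite -cardE leq_subLR cardsC.
Qed.

(** * Punctured codes and robustness *)

Section Puncture.
Variables (I : finType) (C : code I) (A : {set I}).

Lemma min_dist_puncture : (#|~: A| < min_dist C)%N ->
  (min_dist C - #|~: A| <= min_dist (puncture A C))%N.
Proof.
move=> AC; apply: min_weight_ge.
  (* An empty minimum gives the length plus one, so the bound must not exceed [#|A|.+1]. *)
  have := min_dist_leS C; rewrite card_sig -(cardsC A) => h.
  by have -> : #|[pred x | x \in A]| = #|A| by []; lia.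
move=> y /andP[/memv_imgP[c Cc ->]]; rewrite lfunE /= => y0.
have c0 : c != 0 by apply: contraNneq y0 => ->; rewrite linear0.
have := min_dist_le Cc c0.
suff : (wt c <= wt (restrict_word A c) + #|~: A|)%N by lia.
rewrite /wt -(card_imset [set i | restrict_word A c i != 0] val_inj).
apply: leq_trans (leq_card_setU _ _); apply/subset_leq_card/subsetP => i.
rewrite !inE => ci; case: (boolP (i \in A)) => Ai; last by rewrite orbT.
rewrite orbF; apply/imsetP; exists (exist _ i Ai) => //.
by rewrite inE ffunE.
Qed.

End Puncture.

Section RobustTransfer.
Variables (R : realType) (I J : finType) (C : code I) (D : code J) (w p : R).

(** Robustness of the punctured code, read on full matrices. The sets [A], [B] are padded to exactly
    [e] elements, [x] is restricted to the complements, and the sets found there are joined to the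
    padded ones, whence the summand [e]. The denominators drop by [e], the most that puncturing
    takes from a distance. *)
Lemma robust_punctE (e : nat) (A : {set I}) (B : {set J}) (x : word (I * J)) (m : nat) :
    robust_punct w p C D -> e%:R <= p ->
    (#|A| <= e)%N -> (#|B| <= e)%N -> (e <= #|I|)%N -> (e <= #|J|)%N ->
    (e < min_dist C)%N -> (e < min_dist D)%N ->
    x \in dual_tensor C D ->
    (#|[set ij | [&& x ij != 0%R, ij.1 \notin A & ij.2 \notin B]]| <= m)%N -> m%:R <= w ->
  exists A' : {set I}, exists B' : {set J},
    [/\ #|A'|%:R <= e%:R + m%:R / (min_dist D - e)%:R :> R,
        #|B'|%:R <= e%:R + m%:R / (min_dist C - e)%:R :> R,
        A \subset A', B \subset B' &
        forall i j, i \notin A' -> j \notin B' -> x (i, j) = 0].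
Proof.
move=> rob ep Ae Be eI eJ eC eD /mem_dual_tensorP[c [r [cC rD xE]]] xm mw.
have [A1 AA1 A1e] : exists2 A1 : {set I}, A \subset A1 & #|A1| = e by apply: set_enlarge; rewrite Ae.
have [B1 BB1 B1e] : exists2 B1 : {set J}, B \subset B1 & #|B1| = e by apply: set_enlarge; rewrite Be.
pose rst (y : word (I * J)) : word ({i | i \in ~: A1} * {j | j \in ~: B1}) :=
  [ffun ij => y (val ij.1, val ij.2)].
have xD : rst x \in dual_tensor (puncture (~: A1) C) (puncture (~: B1) D).
  apply/mem_dual_tensorP; exists (rst c), (rst r); split; last first.
  - by apply/ffunP => ij; rewrite xE !ffunE.
  - apply/mem_rows_inP => i; have -> : row_word i (rst r) = linfun (restrict_word (~: B1)) (row_word (val i) r).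
      by apply/ffunP => j; rewrite lfunE !ffunE.
    by rewrite memv_img //; move/mem_rows_inP: rD.
  apply/mem_cols_inP => j; have -> : col_word j (rst c) = linfun (restrict_word (~: A1)) (col_word (val j) c).
    by apply/ffunP => i; rewrite lfunE !ffunE.
  by rewrite memv_img //; move/mem_cols_inP: cC.
have wx : (wt (rst x) <= m)%N.
  apply: leq_trans xm; rewrite /wt.
  pose f (ij : {i | i \in ~: A1} * {j | j \in ~: B1}) := (val ij.1, val ij.2).
  have f_inj : injective f by move=> [i j] [i' j'] [/val_inj -> /val_inj ->].
  rewrite -(card_imset _ f_inj); apply/subset_leq_card/subsetP => _ /imsetP[[[i Ai] [j Bj]] h ->].
  move: h; rewrite !inE ffunE /= => ->.
  have Ai' := Ai; have Bj' := Bj; rewrite in_setC in Ai'; rewrite in_setC in Bj'.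
  by rewrite (contra (subsetP AA1 _)) // (contra (subsetP BB1 _)).
have [|||A2 [B2 [A2x B2x x0]]] := rob e (~: A1) (~: B1) ep _ _ (rst x) xD.
- by rewrite addnC -A1e cardsC.
- by rewrite addnC -B1e cardsC.
- by apply: le_trans mw; rewrite ler_nat.
exists (A1 :|: [set val i | i in A2]), (B1 :|: [set val j | j in B2]); split.
- apply: (@le_trans _ _ (#|A1| + #|A2|)%:R).
    by rewrite ler_nat (leq_trans (leq_card_setU _ _)) // leq_add2l leq_imset_card.
  rewrite natrD A1e lerD2l; apply: le_trans A2x _.
  have h := min_dist_puncture (C := D) (A := ~: B1); rewrite setCK B1e in h.
  have {}h := h eD; have pos : (0 < min_dist D - e)%N by rewrite subn_gt0.
  apply: ler_pM; [exact: ler0n | by rewrite invr_ge0 ler0n | by rewrite ler_nat |].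
  rewrite lef_pV2; first by rewrite ler_nat.
    by rewrite posrE ltr0n (leq_trans pos h).
  by rewrite posrE ltr0n.
- apply: (@le_trans _ _ (#|B1| + #|B2|)%:R).
    by rewrite ler_nat (leq_trans (leq_card_setU _ _)) // leq_add2l leq_imset_card.
  rewrite natrD B1e lerD2l; apply: le_trans B2x _.
  have h := min_dist_puncture (C := C) (A := ~: A1); rewrite setCK A1e in h.
  have {}h := h eC; have pos : (0 < min_dist C - e)%N by rewrite subn_gt0.
  apply: ler_pM; [exact: ler0n | by rewrite invr_ge0 ler0n | by rewrite ler_nat |].
  rewrite lef_pV2; first by rewrite ler_nat.
    by rewrite posrE ltr0n (leq_trans pos h).
  by rewrite posrE ltr0n.
- exact: subset_trans (subsetUl _ _).
- exact: subset_trans (subsetUl _ _).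
move=> i j; rewrite !inE !negb_or => /andP[Ai A2i] /andP[Bj B2j].
rewrite -in_setC in Ai; rewrite -in_setC in Bj.
have := x0 (exist _ i Ai) (exist _ j Bj); rewrite ffunE; apply.
  by apply: contra A2i => h; apply/imsetP; exists (exist _ i Ai).
by apply: contra B2j => h; apply/imsetP; exists (exist _ j Bj).
Qed.

End RobustTransfer.

(** * Spectral bounds *)

Section SymmetricNorm.
Variables (R : rcfType) (n : nat).
Local Open Scope sesquilinear_scope.

(** Over [R[i]] the matrix is Hermitian, so a unitary basis diagonalises it with real entries. These
    are eigenvalues of [M] over [R], hence bounded by [c], and unitary maps preserve the norm. *)
Lemma sum_sqr_mulmx_le (M : 'M[R]_n) (c : R) : M^T = M ->
    (forall l, eigenvalue M l -> `|l| <= c) -> 0 <= c ->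
  forall v : 'rV[R]_n,
  \sum_j ((v *m M) 0 j) ^+ 2 <= c ^+ 2 * \sum_j (v 0 j) ^+ 2.
Proof.
move=> Msym Mc c0 v; pose C : numClosedFieldType := R[i].
pose toC : {rmorphism R -> C} := real_complex R; pose A : 'M[C]_n := map_mx toC M.
have Areal : A \is a realmx.
  by apply/mxOverP => i j; rewrite mxE; apply/complex_realP; exists (M i j).
have Aherm : A \is hermsymmx.
  apply: realsym_hermsym => //; apply/is_hermitianmxP.
  by rewrite expr0 scale1r map_mx_id // map_trmx Msym.
set P := spectralmx A; set d := spectral_diag A.
have PU : P \is unitarymx := spectral_unitarymx A.
have Punit : P \in unitmx := spectral_unit A.
have AE : A = invmx P *m diag_mx d *m P := orthomx_spectralP (hermitian_normalmx Aherm).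
have dc i : `|d 0 i| <= toC c.
  have /mxOverP/(_ 0 i)/complex_realP[l dl] := hermitian_spectral_diag_real Aherm.
  rewrite [d 0 i]dl.
  suff /Mc lc : eigenvalue M l.
    by rewrite normc_def /= expr0n addr0 sqrtr_sqr lecR.
  rewrite eigenvalue_root_char -(fmorph_root toC) map_char_poly -eigenvalue_root_char.
  (* Row [i] of [P] is an eigenvector for the entry [i] of the diagonal, nonzero because [P] is
     invertible. *)
  apply/eigenvalueP; exists (row i P).
    rewrite -/A -row_mul AE !mulmxA mulmxV // mul1mx row_mul.
    by rewrite row_diag_mx -scalemxAl -rowE -/d [d 0 i]dl.
  apply: contraTneq Punit => Pi0; rewrite -row_free_unit; apply/negP => /row_freeP[B PB].
  have := congr1 (fun X => row i X 0 i) PB; rewrite row_mul Pi0 mul0mx !mxE eqxx.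
  by move/eqP; rewrite eq_sym oner_eq0.
pose nrm (u : 'rV[C]_n) := (u *m u ^t*) 0 0.
have nrmE u : nrm u = \sum_j `|u 0 j| ^+ 2.
  by rewrite /nrm mxE; apply: eq_bigr => j _; rewrite !mxE normCK.
have nrmU u (U : 'M[C]_n) : U \is unitarymx -> nrm (u *m U) = nrm u.
  by move=> UU; rewrite /nrm trmx_mul map_mxM mulmxA mulmxtVK.
have nrmR (u : 'rV[R]_n) : nrm (map_mx toC u) = toC (\sum_j (u 0 j) ^+ 2).
  rewrite nrmE rmorph_sum; apply: eq_bigr => j _.
  by rewrite mxE rmorphXn /= real_normK //; apply/complex_realP; exists (u 0 j).
set a := \sum_j _; set b := _ * _.
suff : toC a <= toC b by rewrite lecR.
rewrite /a /b rmorphM rmorphXn -!nrmR map_mxM.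
rewrite -/A AE mulmxA nrmU // mulmxA.
have <- : nrm (map_mx toC v *m invmx P) = nrm (map_mx toC v).
  by rewrite nrmU // invmx_unitary // trmxC_unitary.
rewrite !nrmE mulr_sumr; apply: ler_sum => j _.
rewrite mul_mx_diag mxE normrM exprMn mulrC ler_wpM2r ?exprn_ge0 //.
by rewrite lerXn2r ?nnegrE // ler0c.
Qed.

End SymmetricNorm.

(** * Expander mixing and the Ramanujan bound *)

Section Mixing.
Variable R : realType.

Lemma sum_constr (T : finType) (x : R) : \sum_(i : T) x = x * #|T|%:R.
Proof. by rewrite sumr_const mulr_natr. Qed.

(** Cauchy-Schwarz, from the nonnegativity of the variance of [h] on [A]. *)
Lemma sqr_sum_le (T : finType) (A : {set T}) (h : T -> R) :
  (\sum_(x in A) h x) ^+ 2 <= #|A|%:R * \sum_x h x ^+ 2.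
Proof.
set s := \sum_(x in A) h x; have [A0|A0] := posnP #|A|.
  by rewrite /s (cards0_eq A0) big_set0 expr0n mulr_ge0 ?ler0n ?sumr_ge0 // => x _; apply: sqr_ge0.
have a0 : 0 < #|A|%:R :> R by rewrite ltr0n.
apply: (@le_trans _ _ (#|A|%:R * \sum_(x in A) h x ^+ 2)); last first.
  rewrite ler_pM2l // [leLHS]big_mkcond /=; apply: ler_sum => x _.
  by case: ifP => // _; apply: sqr_ge0.
have : 0 <= \sum_(x in A) (h x - s / #|A|%:R) ^+ 2 by apply: sumr_ge0 => x _; apply: sqr_ge0.
set Q := \sum_(x in A) h x ^+ 2.
have -> : \sum_(x in A) (h x - s / #|A|%:R) ^+ 2 = Q - s ^+ 2 / #|A|%:R.
  under eq_bigr do rewrite sqrrB.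
  rewrite big_split sumrB /= sumrMnl -mulr_suml -/s -/Q sumr_const.
  rewrite -[_ *+ #|A|]mulr_natr -[_ *+ 2]mulr_natr; field; exact: lt0r_neq0.
by rewrite subr_ge0 ler_pdivrMr // mulrC.
Qed.

Section Operator.
Variables (T K : finType) (sigma : K -> T -> T) (c : R).
Hypothesis c_ge0 : 0 <= c.
Hypothesis contraction : forall f : T -> R, \sum_x f x = 0 ->
  \sum_x (\sum_k f (sigma k x)) ^+ 2 <= c ^+ 2 * \sum_x f x ^+ 2.

(** Stated for a family of maps [sigma], so that edges and diagonals of squares are treated alike.
    The indicator of [S] is its mean, which gives the main term, plus a function [f] of sum zero,
    handled by Cauchy-Schwarz on [U] and the contraction. *)
Lemma expander_mixing (S U : {set T}) :
  \sum_(x in U) \sum_k (sigma k x \in S)%:R <=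
    #|K|%:R * (#|S|%:R * #|U|%:R) / #|T|%:R + c * Num.sqrt (#|S|%:R * #|U|%:R).
Proof.
have [T0|T0] := posnP #|T|.
  have -> : \sum_(x in U) \sum_k (sigma k x \in S)%:R = 0 :> R.
    by apply: big1 => x; have := fintype0 x; rewrite T0 => /(_ erefl).
  by rewrite T0 invr0 mulr0 add0r mulr_ge0 ?sqrtr_ge0.
have n0 : #|T|%:R != 0 :> R by rewrite pnatr_eq0 -lt0n.
pose a : R := #|S|%:R / #|T|%:R; pose f x : R := (x \in S)%:R - a.
have sS : \sum_x (x \in S)%:R = #|S|%:R :> R.
  by rewrite -sum1_card natr_sum [RHS]big_mkcond /=; apply: eq_bigr => x _; case: (x \in S).
have f0 : \sum_x f x = 0.
  by rewrite sumrB sS sum_constr divfK ?subrr.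
have f2 : \sum_x f x ^+ 2 <= #|S|%:R.
  have -> : \sum_x f x ^+ 2 = \sum_x ((x \in S)%:R * (1 - 2 * a) + a ^+ 2).
    by apply: eq_bigr => x _; rewrite /f; case: (x \in S) => /=; ring.
  rewrite big_split /= -mulr_suml sS sum_constr.
  have -> : #|S|%:R * (1 - 2 * a) + a ^+ 2 * #|T|%:R = #|S|%:R - #|S|%:R ^+ 2 / #|T|%:R by rewrite /a; field.
  by rewrite lerBlDr lerDl divr_ge0 ?sqr_ge0.
have -> : \sum_(x in U) \sum_k (sigma k x \in S)%:R =
    #|K|%:R * (#|S|%:R * #|U|%:R) / #|T|%:R + \sum_(x in U) \sum_k f (sigma k x).
  have fE x : \sum_k f (sigma k x) = \sum_k (sigma k x \in S)%:R - a * #|K|%:R.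
    by rewrite sumrB sum_constr.
  rewrite (eq_bigr _ (fun x _ => fE x)) sumrB sumr_const -[_ *+ #|U|]mulr_natr /a.
  by set X := \sum_(x in U) _; field.
rewrite lerD2l; set Z := \sum_(x in U) _; apply: le_trans (ler_norm Z) _.
rewrite -sqrtr_sqr -[c in c * _](ger0_norm c_ge0) -sqrtr_sqr -sqrtrM ?sqr_ge0 // ler_wsqrtr //.
apply: le_trans (sqr_sum_le _ _) _.
have := le_trans (contraction f0) (ler_wpM2l (sqr_ge0 c) f2).
by move/(ler_wpM2l (ler0n R #|U|)); rewrite [X in _ <= X]mulrC -mulrA.
Qed.

End Operator.

Section RamanujanContraction.
Variables (T : finType) (e : rel T) (d : nat).
Hypothesis e_sym : symmetric e.
Hypothesis e_reg : forall x, #|[set y | e x y]| = d.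

(** Maximum principle: the neighbours of a maximum average to it, so all attain it, and connectivity
    spreads this to every vertex. *)
Lemma harmonic_const (f : T -> R) : connected_graph e ->
    (forall x, \sum_(y | e x y) f y = d%:R * f x) ->
  forall x y, f x = f y.
Proof.
move=> conn harm x y; pose m := [arg max_(i > x) f i]%O.
have fm z : f z <= f m by rewrite /m; case: arg_maxP => // i _; apply.
suff fz z : connect e m z -> f z = f m by rewrite !fz.
case/connectP => s; elim/last_ind: s z => [z _ -> //|s w IHs z].
rewrite rcons_path last_rcons => /andP[es ew ->].
have {IHs} fl := IHs _ es erefl.
have : \sum_(y | e (last m s) y) (f m - f y) = 0.
  rewrite sumrB harm fl sumr_const -(e_reg (last m s)) -[_ *+ _]mulr_natl cardsE.
  by rewrite subrr.
move/eqP; rewrite psumr_eq0; last by move=> y' _; rewrite subr_ge0 fm.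
by move/allP/(_ w); rewrite mem_index_enum ew subr_eq0 => /(_ isT)/eqP.
Qed.

(** Subtracting [d / #|T|] from every entry sends the eigenvalue of constants to 0 and changes
    nothing on functions of sum zero, so all eigenvalues of [M] obey the Ramanujan bound, relaxed to
    [2 * Num.sqrt d%:R]. *)
Lemma Ramanujan_contraction (f : T -> R) : Ramanujan R d e -> \sum_x f x = 0 ->
  \sum_x (\sum_(y | e x y) f y) ^+ 2 <= (2 * Num.sqrt d%:R) ^+ 2 * \sum_x f x ^+ 2.
Proof.
case=> conn _ eig f0; have [T0|T0] := posnP #|T|.
  rewrite [leLHS]big1 => [|x _]; last by have := fintype0 x; rewrite T0 => /(_ erefl).
  by apply: mulr_ge0; rewrite ?sqr_ge0 ?sumr_ge0 // => x _; rewrite sqr_ge0.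
have n0 : #|T|%:R != 0 :> R by rewrite pnatr_eq0 -lt0n.
pose Adj := adjacency R e; pose a : R := d%:R / #|T|%:R; pose M := Adj - const_mx a.
pose fn (v : 'rV[R]_#|T|) x := v 0 (enum_rank x).
have vAdj v j : (v *m Adj) 0 j = \sum_(y | e (enum_val j) y) fn v y.
  rewrite mxE (reindex enum_rank) /=; last exact: onW_bij (enum_rank_bij T).
  rewrite [RHS]big_mkcond /=; apply: eq_bigr => y _.
  by rewrite mxE enum_rankK e_sym; case: ifP; rewrite ?mulr1 ?mulr0.
have vconst v j : (v *m const_mx a) 0 j = (\sum_x fn v x) * a :> R.
  rewrite mxE (reindex enum_rank) /=; last exact: onW_bij (enum_rank_bij T).
  by rewrite mulr_suml; apply: eq_bigr => y _; rewrite mxE.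
have rowB (u w : 'rV[R]_#|T|) j : (u - w) 0 j = u 0 j - w 0 j by rewrite !mxE.
have Msym : M^T = M.
  by apply/matrixP => i j; rewrite !mxE e_sym.
have sumAdj v : \sum_x \sum_(y | e x y) fn v y = d%:R * \sum_x fn v x.
  rewrite (exchange_big_dep predT) //= mulr_sumr; apply: eq_bigr => y _.
  rewrite sumr_const -[_ *+ _]mulr_natl -(e_reg y) cardsE.
  by congr (_%:R * _); apply: eq_card => x; exact: e_sym.
have Mc l : eigenvalue M l -> `|l| <= 2 * Num.sqrt d%:R.
  case/eigenvalueP => v vM v0; have [->|l0] := eqVneq l 0.
    by rewrite normr0 mulr_ge0 ?sqrtr_ge0.
  have vMj x : \sum_(y | e x y) fn v y - (\sum_z fn v z) * a = l * fn v x.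
    have := congr1 (fun u : 'rV_ _ => u 0 (enum_rank x)) vM.
    by rewrite mulmxBr rowB vAdj vconst enum_rankK mxE.
  (* Summed over all vertices, the left-hand side of the eigenvalue equation cancels by regularity,
     and [l] is nonzero. *)
  have sumv : \sum_z fn v z = 0.
    apply: (mulfI l0); rewrite mulr0 mulr_sumr -(eq_bigr _ (fun x _ => vMj x)).
    by rewrite sumrB sumAdj sum_constr /a; set s := \sum_z _; field.
  have {}vMj x : \sum_(y | e x y) fn v y = l * fn v x by rewrite -vMj sumv mul0r subr0.
  have lM : eigenvalue Adj l.
    apply/eigenvalueP; exists v => //; apply/rowP => j.
    by rewrite vAdj vMj /fn enum_valK mxE.
  apply: le_trans (eig l lM _) _.
    (* An eigenvector for [d] is constant, and sum zero makes it vanish. *)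
    apply: contraNneq v0 => ld; rewrite ld in vMj.
    have fc := harmonic_const conn vMj.
    apply/eqP/rowP => j; rewrite mxE; have := sumv.
    rewrite (eq_bigr _ (fun x _ => fc x (enum_val j))) sum_constr => /eqP.
    by rewrite mulf_eq0 (negPf n0) orbF /fn enum_valK => /eqP.
  by rewrite ler_pM2l // ler_wsqrtr // lerBlDr lerDl.
pose v : 'rV[R]_#|T| := \row_j f (enum_val j).
have fnv x : fn v x = f x by rewrite /fn mxE enum_rankK.
have <- : \sum_j (v 0 j) ^+ 2 = \sum_x f x ^+ 2.
  rewrite (reindex enum_rank) /=; last exact: onW_bij (enum_rank_bij T).
  by apply: eq_bigr => x _; rewrite -fnv.
have -> : \sum_x (\sum_(y | e x y) f y) ^+ 2 = \sum_j ((v *m M) 0 j) ^+ 2.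
  rewrite [RHS](reindex enum_rank) /=; last exact: onW_bij (enum_rank_bij T).
  apply: eq_bigr => x _; rewrite mulmxBr rowB vAdj vconst enum_rankK.
  rewrite [\sum_x0 fn v x0](eq_bigr f) // f0 mul0r subr0.
  by congr (_ ^+ 2); apply: eq_bigr => y _.
by apply: sum_sqr_mulmx_le => //; rewrite mulr_ge0 ?sqrtr_ge0.
Qed.

End RamanujanContraction.
End Mixing.

(** * Mixing in left and right Cayley graphs *)

Section CayleyMixing.
Variables (R : realType) (gT : finGroupType) (d : nat).
Implicit Types (A S U : {set gT}) (al : 'I_d -> gT).

Section Contraction.
Variables (A : {set gT}) (al : 'I_d -> gT).
Hypotheses (AV : (A^-1)%g = A) (al_inj : injective al).
Hypothesis al_im : [set al i | i : 'I_d] = A.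

Let mem_al x : reflect (exists k, x = al k) (x \in A).
Proof. by rewrite -al_im; apply: (iffP imsetP) => [[k _ ->]|[k ->]]; exists k. Qed.

Lemma Cay_leftE x y : Cay_left A x y = (y \in [set al k * x | k : 'I_d]%g).
Proof.
apply/existsP/imsetP => [[a /andP[/mem_al[k ->] /eqP ->]]|[k _ ->]]; first by exists k.
by exists (al k); rewrite eqxx andbT; apply/mem_al; exists k.
Qed.

Lemma Cay_rightE x y : Cay_right A x y = (y \in [set x * al k | k : 'I_d]%g).
Proof.
apply/existsP/imsetP => [[a /andP[/mem_al[k ->] /eqP ->]]|[k _ ->]]; first by exists k.
by exists (al k); rewrite eqxx andbT; apply/mem_al; exists k.
Qed.

Lemma Cay_left_contraction (f : gT -> R) : Ramanujan R d (Cay_left A) ->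
    \sum_x f x = 0 ->
  \sum_x (\sum_k f (al k * x)%g) ^+ 2 <= (2 * Num.sqrt d%:R) ^+ 2 * \sum_x f x ^+ 2.
Proof.
have inj x : injective (fun k => al k * x)%g by move=> k l /mulIg /al_inj.
move=> ram f0; apply: le_trans (Ramanujan_contraction _ _ ram f0); last first.
- move=> x; rewrite -[RHS]card_ord -(card_imset _ (inj x)) -[RHS]cardsE.
  by congr #|pred_of_set _|; apply/setP => y; rewrite !inE Cay_leftE.
- move=> x y; apply/existsP/existsP => -[a /andP[Aa /eqP ->]];
  by exists a^-1%g; rewrite -mem_invg AV Aa mulKg eqxx.
apply: ler_sum => x _; rewrite (eq_bigl _ _ (Cay_leftE x)) big_imset //=.
by move=> k l _ _ /inj.
Qed.

Lemma Cay_right_contraction (f : gT -> R) : Ramanujan R d (Cay_right A) ->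
    \sum_x f x = 0 ->
  \sum_x (\sum_k f (x * al k)%g) ^+ 2 <= (2 * Num.sqrt d%:R) ^+ 2 * \sum_x f x ^+ 2.
Proof.
have inj x : injective (fun k => x * al k)%g by move=> k l /mulgI /al_inj.
move=> ram f0; apply: le_trans (Ramanujan_contraction _ _ ram f0); last first.
- move=> x; rewrite -[RHS]card_ord -(card_imset _ (inj x)) -[RHS]cardsE.
  by congr #|pred_of_set _|; apply/setP => y; rewrite !inE Cay_rightE.
- move=> x y; apply/existsP/existsP => -[a /andP[Aa /eqP ->]];
  by exists a^-1%g; rewrite -mem_invg AV Aa mulgK eqxx.
apply: ler_sum => x _; rewrite (eq_bigl _ _ (Cay_rightE x)) big_imset //=.
by move=> k l _ _ /inj.
Qed.

End Contraction.

Variables (A B : {set gT}) (al be : 'I_d -> gT).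
Hypotheses (AV : (A^-1)%g = A) (BV : (B^-1)%g = B).
Hypotheses (al_inj : injective al) (al_im : [set al i | i : 'I_d] = A).
Hypotheses (be_inj : injective be) (be_im : [set be i | i : 'I_d] = B).
Hypotheses (ramA : Ramanujan R d (Cay_left A)) (ramB : Ramanujan R d (Cay_right B)).

Let c0 : 0 <= 2 * Num.sqrt d%:R :> R. Proof. by rewrite mulr_ge0 ?sqrtr_ge0. Qed.

Lemma mixing_left S U :
  \sum_(x in U) \sum_k (al k * x \in S)%g%:R <=
    d%:R * (#|S|%:R * #|U|%:R) / #|gT|%:R + 2 * Num.sqrt d%:R * Num.sqrt (#|S|%:R * #|U|%:R) :> R.
Proof.
rewrite -[X in X%:R * (_ * _)]card_ord; apply: (expander_mixing (sigma := fun k x => (al k * x)%g)) => //.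
by move=> f; apply: (Cay_left_contraction AV al_inj al_im ramA).
Qed.

Lemma mixing_right S U :
  \sum_(x in U) \sum_k (x * be k \in S)%g%:R <=
    d%:R * (#|S|%:R * #|U|%:R) / #|gT|%:R + 2 * Num.sqrt d%:R * Num.sqrt (#|S|%:R * #|U|%:R) :> R.
Proof.
rewrite -[X in X%:R * (_ * _)]card_ord; apply: (expander_mixing (sigma := fun k x => (x * be k)%g)) => //.
by move=> f; apply: (Cay_right_contraction BV be_inj be_im ramB).
Qed.

(** Passing to the opposite corner of a square composes a left and a right Cayley step. Summing over
    right translates keeps sum zero, so the two contractions multiply. *)
Lemma mixing_square S U :
  \sum_(x in U) \sum_kl (al kl.1 * x * be kl.2 \in S)%g%:R <=
    d%:R ^+ 2 * (#|S|%:R * #|U|%:R) / #|gT|%:R + 4 * d%:R * Num.sqrt (#|S|%:R * #|U|%:R) :> R.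
Proof.
have -> : 4 * d%:R = (2 * Num.sqrt d%:R) * (2 * Num.sqrt d%:R) :> R.
  by rewrite -expr2 exprMn sqr_sqrtr ?ler0n //; ring.
have -> : d%:R ^+ 2 = #|{: 'I_d * 'I_d}|%:R :> R by rewrite card_prod card_ord natrM.
apply: (expander_mixing (sigma := fun kl x => (al kl.1 * x * be kl.2)%g)); first exact: mulr_ge0.
move=> f f0; pose h x := \sum_l f (x * be l)%g.
have h0 : \sum_x h x = 0.
  rewrite exchange_big big1 // => l _; rewrite -[RHS]f0 [RHS](reindex (mulg^~ (be l))) //.
  by exists (mulg^~ (be l)^-1)%g => x _; rewrite ?mulgK ?mulgKV.
rewrite (eq_bigr (fun x => (\sum_k h (al k * x)%g) ^+ 2)); last first.
  by move=> x _; rewrite /h pair_bigA.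
apply: le_trans (Cay_left_contraction AV al_inj al_im ramA h0) _.
rewrite [in leRHS]exprMn -[leRHS]mulrA; apply: ler_wpM2l; first exact: sqr_ge0.
exact: (Cay_right_contraction BV be_inj be_im ramB f0).
Qed.

End CayleyMixing.

(** * Squares and local views *)

Lemma inverse_index (gT : finGroupType) (A : {set gT}) n (al : 'I_n -> gT) :
    (A^-1)%g = A -> [set al i | i : 'I_n] = A ->
  exists s : 'I_n -> 'I_n, forall k, al (s k) = (al k)^-1%g.
Proof.
move=> AV al_im; apply: (fin_all_exists (P := fun k k' => al k' = (al k)^-1%g)) => k.
have : ((al k)^-1)%g \in A by rewrite -AV memV_invg -al_im imset_f.
by rewrite -al_im => /imsetP[k' _ ->]; exists k'.
Qed.

Section LocalViews.
Variables (gT : finGroupType) (A B : {set gT}) (n : nat) (al be : 'I_n -> gT).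
Variables (si ti : 'I_n -> 'I_n).
Hypotheses (tnc : TNC A B).
Hypotheses (al_inj : injective al) (al_im : [set al i | i : 'I_n] = A).
Hypotheses (be_inj : injective be) (be_im : [set be i | i : 'I_n] = B).
Hypotheses (al_si : forall k, al (si k) = (al k)^-1%g).
Hypotheses (be_ti : forall l, be (ti l) = (be l)^-1%g).
Implicit Types (x y : word (sq A B)) (t : word ('I_n * 'I_n)) (g : gT) (i : bool).

Lemma mem_al k : al k \in A. Proof. by rewrite -al_im imset_f. Qed.
Lemma mem_be k : be k \in B. Proof. by rewrite -be_im imset_f. Qed.

Lemma siK : involutive si.
Proof. by move=> k; apply: al_inj; rewrite !al_si invgK. Qed.
Lemma tiK : involutive ti.
Proof. by move=> k; apply: be_inj; rewrite !be_ti invgK. Qed.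

Lemma tnc_index g k l : (al k * g != g * be l)%g.
Proof. by apply/eqP; apply: tnc; rewrite ?mem_al ?mem_be. Qed.

Lemma tnc_index2 g k l : (al k * g * be l != g)%g.
Proof.
apply: contraNneq (tnc_index g k (ti l)) => e.
by rewrite -{2}e be_ti mulgK.
Qed.

(** Crossing the edge to [al k * g] keeps the square and the label [b] but inverts the label of the
    edge; this is why adjacent views share a whole row. *)
Lemma square_left g i k b :
  square ((al k * g)%g, ~~ i) (al (si k)) b = square (g, i) (al k) b.
Proof.
rewrite /square /= negbK al_si mulKg; apply/setP => z; rewrite !inE.
by do 4?case: (z == _).
Qed.

Lemma square_right g i a l :
  square ((g * be l)%g, ~~ i) a (be (ti l)) = square (g, i) a (be l).
Proof.
rewrite /square /= negbK be_ti mulgK !mulgA mulgK; apply/setP => z; rewrite !inE.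
by do 4?case: (z == _).
Qed.

Lemma square_same_side g h i k l k' l' :
    square (g, i) (al k) (be l) = square (h, i) (al k') (be l') ->
  g = h \/ g = (al k' * h * be l')%g.
Proof.
move/setP/(_ (g, i)); rewrite !inE eqxx /= => /esym /orP[/orP[/orP[]|]|] /eqP[];
  by [left | move=> _; case: i | right].
Qed.

Lemma square_other_side g h i k l k' l' :
    square (g, i) (al k) (be l) = square (h, ~~ i) (al k') (be l') ->
  g = (al k' * h)%g \/ g = (h * be l')%g.
Proof.
move/setP/(_ (g, i)); rewrite !inE eqxx /= => /esym /orP[/orP[/orP[]|]|] /eqP[];
  by [left | right | move=> _; case: i].
Qed.

(** Read from the neighbour [al k * g], the two squares can agree only if it is [al k' * g] or
    [g * be l'], and TNC excludes the latter; likewise for [l]. *)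
Lemma square_inj g i k l k' l' :
  square (g, i) (al k) (be l) = square (g, i) (al k') (be l') -> (k, l) = (k', l').
Proof.
move=> e; have := e; rewrite -[RHS]square_left.
rewrite -square_left => /square_same_side /= [/mulIg/al_inj -> |].
  have := e; rewrite -[RHS]square_right -square_right.
  case/square_same_side => [/mulgI/be_inj -> //|].
  rewrite mulgA be_ti mulgK => /eqP; rewrite eq_sym => h.
  by have := tnc_index g k' l; rewrite h.
by rewrite al_si mulKg => h; have := tnc_index g k l'; rewrite h eqxx.
Qed.

Lemma mem_square g i k l : square (g, i) (al k) (be l) \in squares A B.
Proof.
have m g' k' l' : square (g', false) (al k') (be l') \in squares A B.
  rewrite inE; apply/existsP; exists g'; apply/existsP; exists (al k').
  by rewrite mem_al; apply/existsP; exists (be l'); rewrite mem_be eqxx.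
by case: i => //; rewrite -square_left.
Qed.

Lemma squaresP i q : q \in squares A B ->
  exists g k l, q = square (g, i) (al k) (be l).
Proof.
rewrite inE => /existsP[g /existsP[a /andP[]]].
rewrite -al_im => /imsetP[k _ ->] /existsP[b /andP[]].
rewrite -be_im => /imsetP[l _ ->] /eqP ->.
case: i; last by exists g, k, l.
by exists (al k * g)%g, (si k), l; rewrite -[LHS]square_left.
Qed.

Definition sq_of g i (kl : 'I_n * 'I_n) : sq A B :=
  exist (fun q => q \in squares A B) _ (mem_square g i kl.1 kl.2).

Lemma sq_of_inj g i : injective (sq_of g i).
Proof. by move=> [k l] [k' l'] /(congr1 val) /square_inj. Qed.

Lemma local_viewE g i x kl : local_view al be (g, i) x kl = x (sq_of g i kl).
Proof.
rewrite ffunE; case: insubP => [q _ qE|]; last by rewrite mem_square.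
by congr (x _); apply: val_inj.
Qed.

Lemma view_left g i x k l :
  local_view al be ((al k * g)%g, ~~ i) x (si k, l) = local_view al be (g, i) x (k, l).
Proof. by rewrite !local_viewE; congr (x _); apply: val_inj; rewrite /= square_left. Qed.

Lemma view_right g i x k l :
  local_view al be ((g * be l)%g, ~~ i) x (k, ti l) = local_view al be (g, i) x (k, l).
Proof. by rewrite !local_viewE; congr (x _); apply: val_inj; rewrite /= square_right. Qed.

(** A square has two opposite corners on each side, distinct by [tnc_index2], and one pair of labels
    at each. *)
Lemma card_views (i : bool) (q : sq A B) :
  #|[set gkl : gT * ('I_n * 'I_n) | sq_of gkl.1 i gkl.2 == q]| = 2%N.
Proof.
have [g [k [l qE]]] := squaresP i (valP q).
have qE' : val q = square ((al k * g * be l)%g, i) (al (si k)) (be (ti l)).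
  by rewrite qE -(square_left g i k) -(square_right _ (~~ i)) negbK.
have -> : [set gkl : gT * ('I_n * 'I_n) | sq_of gkl.1 i gkl.2 == q] =
    [set (g, (k, l)); ((al k * g * be l)%g, (si k, ti l))].
  apply/setP => -[h [k' l']]; rewrite !inE -val_eqE /=; apply/eqP/orP.
    move=> e; have := e; rewrite qE => /square_same_side [] hE.
      by left; move: e; rewrite hE qE => /square_inj[-> ->].
    by right; move: e; rewrite hE qE' => /square_inj[-> ->].
  by case=> /eqP[-> -> ->].
by rewrite cards2 xpair_eqE eq_sym (negPf (tnc_index2 g k l)).
Qed.

Lemma sum_views (i : bool) (F : sq A B -> nat) :
  (\sum_g \sum_kl F (sq_of g i kl) = 2 * \sum_q F q)%N.
Proof.
rewrite pair_bigA /= (partition_big (fun gkl => sq_of gkl.1 i gkl.2) predT) //=.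
rewrite big_distrr; apply: eq_bigr => q _.
rewrite (eq_bigr (fun=> F q)); last by move=> j /eqP ->.
by rewrite sum_nat_const -(card_views i q) cardsE.
Qed.

Lemma sum_wt_view (i : bool) x : (\sum_g wt (local_view al be (g, i) x) = 2 * wt x)%N.
Proof.
rewrite [wt x]wt_sum -(sum_views i); apply: eq_bigr => g _; rewrite wt_sum.
by apply: eq_bigr => kl _; rewrite local_viewE.
Qed.

Lemma card_squares : (2 * #|squares A B| = #|gT| * n ^ 2)%N.
Proof.
have <- : #|{: sq A B}| = #|squares A B| by rewrite card_sig; apply: eq_card.
rewrite -[#|{: _}|]sum1_card -(sum_views false (fun=> 1%N)).
rewrite (eq_bigr (fun=> n ^ 2)%N); first by rewrite sum_nat_const.
by move=> g _; rewrite sum1_card card_prod card_ord.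
Qed.

(** Extension of a local matrix by zero; the sum has at most one term, as [sq_of g i] is
    injective. *)
Definition embed g i t : word (sq A B) :=
  [ffun q => \sum_(kl | sq_of g i kl == q) t kl].

Lemma embedE g i t kl : embed g i t (sq_of g i kl) = t kl.
Proof.
rewrite ffunE (big_pred1 kl) // => kl'.
by apply: (inj_eq (@sq_of_inj g i)).
Qed.

Lemma embed_out g i t q : (forall kl, sq_of g i kl != q) -> embed g i t q = 0.
Proof. by move=> h; rewrite ffunE big1 // => kl /eqP e; have := h kl; rewrite e eqxx. Qed.

Lemma local_view_embed g i t : local_view al be (g, i) (embed g i t) = t.
Proof. by apply/ffunP => kl; rewrite local_viewE embedE. Qed.

Lemma dotp_embed g i x t : dotp x (embed g i t) = dotp (local_view al be (g, i) x) t.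
Proof.
rewrite /dotp [RHS](partition_big (sq_of g i) predT) //=; apply: eq_bigr => q _.
by rewrite ffunE mulr_sumr; apply: eq_bigr => kl /eqP <-; rewrite local_viewE.
Qed.

Lemma wt_split g i x :
  wt x = (wt (local_view al be (g, i) x) +
    \sum_(q | q \notin codom (sq_of g i)) (x q != 0%R))%N.
Proof.
rewrite [LHS]wt_sum (bigID (mem (codom (sq_of g i)))) /=; congr addn.
rewrite wt_sum -big_uniq /=; last exact/injectiveP/sq_of_inj.
rewrite big_map -big_enum /= enumT; apply: eq_bigr => kl _; by rewrite local_viewE.
Qed.

Lemma wt_add_embed g i x t :
  (wt (local_view al be (g, i) x + t)%R < wt (local_view al be (g, i) x))%N ->
  (wt (x + embed g i t)%R < wt x)%N.
Proof.
move=> h; rewrite (wt_split g i x) (wt_split g i (x + _)) linearD /= local_view_embed.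
rewrite (eq_bigr (fun q => nat_of_bool (x q != 0))) ?ltn_add2r //.
move=> q qout; rewrite ffunE embed_out ?addr0 // => kl.
by apply: contraNneq qout => <-; apply: codom_f.
Qed.

(** A view at [h] meets the squares of [g] only if the vertices are adjacent, through an [A]-edge or
    a [B]-edge but never both by TNC. It then consists of one row of [t], a word of [D], or of one
    column, a word of [C]. *)
Lemma embed_dual_tensor (C D : code 'I_n) g h i t : t \in tensor C D ->
  local_view al be (h, ~~ i) (embed g i t) \in dual_tensor C D.
Proof.
rewrite memv_cap => /andP[/mem_cols_inP tC /mem_rows_inP tD].
set y := local_view _ _ _ _; apply/mem_dual_tensorP.
have y0 k l : y (k, l) != 0 -> g = (al k * h)%g \/ g = (h * be l)%g.
  move=> ykl; have : [exists kl, sq_of g i kl == sq_of h (~~ i) (k, l)].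
    apply: contraNT ykl; rewrite negb_exists => /forallP nn.
    by rewrite /y local_viewE embed_out.
  by case/existsP => kl /eqP/(congr1 val)/square_other_side.
have [/existsP[k /eqP gE]|/existsPn noA] := boolP [exists k, g == (al k * h)%g].
  exists 0, y; rewrite mem0v add0r; split=> //; apply/mem_rows_inP => k'.
  have [->|kk'] := eqVneq k' k.
    have -> : row_word k y = row_word (si k) t; last exact: tD.
    apply/ffunP => l; rewrite [LHS]ffunE [RHS]ffunE /y -view_left -gE negbK.
    by rewrite local_view_embed.
  have -> : row_word k' y = 0; last exact: mem0v.
  apply/ffunP => l; rewrite [LHS]ffunE [RHS]ffunE.
  apply/eqP; apply: contraT; case/y0 => e.
    by move: kk'; rewrite (al_inj (mulIg _ _ _ (etrans (esym e) gE))) eqxx.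
  by have /eqP[] := tnc_index h k l; rewrite -gE.
(* This branch also covers non-adjacent vertices, where every column is zero. *)
exists y, 0; rewrite mem0v addr0; split=> //; apply/mem_cols_inP => l'.
have [gE|gl'] := eqVneq g (h * be l')%g.
  have -> : col_word l' y = col_word (ti l') t; last exact: tC.
  apply/ffunP => k; rewrite [LHS]ffunE [RHS]ffunE /y -view_right -gE negbK.
  by rewrite local_view_embed.
have -> : col_word l' y = 0; last exact: mem0v.
apply/ffunP => k; rewrite [LHS]ffunE [RHS]ffunE.
apply/eqP; apply: contraT; case/y0 => e.
  by have := noA k; rewrite e eqxx.
by rewrite e eqxx in gl'.
Qed.

End LocalViews.

(** * Reduction of light codewords *)

Section LocalCodes.
Variables (R : realType) (d : nat) (C D : code 'I_d) (w p delta : R).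
Hypothesis rob : robust_punct w p C D.
Hypotheses (p_ge0 : 0 <= p) (delta_gt0 : 0 < delta).
Hypotheses (hC : delta * d%:R <= (min_dist C)%:R) (hD : delta * d%:R <= (min_dist D)%:R).
Hypothesis d_gt0 : (0 < d)%N.
Implicit Types (y z c r t : word ('I_d * 'I_d)).

Let dd_gt0 : 0 < delta * d%:R. Proof. by rewrite mulr_gt0 ?ltr0n. Qed.

Let minC_gt0 : (0 < min_dist C)%N.
Proof. by rewrite -(ltr0n R); apply: lt_le_trans hC. Qed.

Let minD_gt0 : (0 < min_dist D)%N.
Proof. by rewrite -(ltr0n R); apply: lt_le_trans hD. Qed.

Lemma addF2_eq0 (a b : F2) : (a + b == 0) = (a == b).
Proof. by rewrite addr_eq0 (_ : - b = b) //; apply: oppr_pchar2. Qed.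

Lemma robust_full y : y \in dual_tensor C D -> (wt y)%:R <= w ->
  exists A' : {set 'I_d}, exists B' : {set 'I_d},
    [/\ #|A'|%:R <= (wt y)%:R / (delta * d%:R), #|B'|%:R <= (wt y)%:R / (delta * d%:R) &
        forall k l, k \notin A' -> l \notin B' -> y (k, l) = 0].
Proof.
move=> yD yw.
have [||||||||||A' [B' [A'b B'b _ _ y0]]] :=
  @robust_punctE R 'I_d 'I_d C D w p 0 set0 set0 y (wt y) rob; rewrite ?cards0 //.
  by apply/subset_leq_card/subsetP => kl; rewrite !inE => /andP[].
exists A', B'; split=> //.
  apply: le_trans A'b _; rewrite add0r subn0 ler_wpM2l ?ler0n // lef_pV2 ?posrE ?ltr0n //.
apply: le_trans B'b _; rewrite add0r subn0 ler_wpM2l ?ler0n // lef_pV2 ?posrE ?ltr0n //.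
Qed.

(** A lighter word is below the robustness threshold and has row and column sets of size less than
    1, so it vanishes. *)
Lemma dual_tensor_wt y : delta * d%:R <= w -> y \in dual_tensor C D -> y != 0 ->
  delta * d%:R <= (wt y)%:R.
Proof.
move=> dw yD; apply: contraNT; rewrite -ltNge => yd.
have [A' [B' [A'b B'b y0]]] := robust_full yD (le_trans (ltW yd) dw).
have empty (E : {set 'I_d}) : #|E|%:R <= (wt y)%:R / (delta * d%:R) -> E = set0.
  move=> Eb; apply/eqP; rewrite -cards_eq0 -leqn0 -ltnS -(ltr_nat R).
  by apply: le_lt_trans Eb _; rewrite ltr_pdivrMr ?mul1r.
by apply/eqP/ffunP => -[k l]; rewrite ffunE y0 // (empty _ A'b, empty _ B'b) inE.
Qed.

(** Off the robust sets [c] and [r] agree, so [tensor_split] gives a tensor codeword equal to [c]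
    off [B'] and to [r] off [A']. Adding it to both keeps their sum in characteristic 2 and confines
    [c] to the columns of [B'] and [r] to the rows of [A']. *)
Lemma normal_split y tau : tau < delta * d%:R ->
    y \in dual_tensor C D -> (wt y)%:R <= w -> (wt y)%:R / (delta * d%:R) <= tau ->
  exists c r, [/\ c \in cols_in 'I_d C, r \in rows_in 'I_d D, y = c + r,
    forall k, (wt (row_word k c))%:R <= tau & forall l, (wt (col_word l r))%:R <= tau].
Proof.
move=> taud yD yw ytau; have [A' [B' [A'b B'b y0]]] := robust_full yD yw.
case/mem_dual_tensorP: yD => c [r [cC rD yE]].
have [|||t [tT tr tc]] := @tensor_split _ _ C D c r A' B' cC rD.
- by move=> k l kA lB; apply/eqP; rewrite -addF2_eq0 -(y0 k l) // yE !ffunE.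
- by rewrite -(ltr_nat R); apply: lt_le_trans hC; apply: le_lt_trans taud; apply: le_trans ytau.
- by rewrite -(ltr_nat R); apply: lt_le_trans hD; apply: le_lt_trans taud; apply: le_trans ytau.
move: tT; rewrite memv_cap => /andP[tC tD].
exists (c + t), (r + t); split; [exact: (memvD cC tC) | exact: (memvD rD tD) | | |].
- by rewrite yE addrACA word_addxx addr0.
- move=> k; apply: le_trans (le_trans B'b ytau); rewrite ler_nat; apply: wt_leq_card => l lB.
  by rewrite !ffunE tc //; apply/eqP; rewrite addF2_eq0.
- move=> l; apply: le_trans (le_trans A'b ytau); rewrite ler_nat; apply: wt_leq_card => k kA.
  by rewrite !ffunE tr //; apply/eqP; rewrite addF2_eq0.
Qed.

(** In the split of [y], a nonzero row of [r] is a codeword of [D], of which [c] alters at most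
    [tau] entries. If [r] vanishes, a nonzero column of [y] is itself a codeword of [C]. *)
Lemma heavy_line y tau : 2 * tau <= delta * d%:R -> tau < delta * d%:R ->
    y \in dual_tensor C D -> (wt y)%:R <= w -> (wt y)%:R / (delta * d%:R) <= tau ->
    y != 0 ->
  (exists k, delta * d%:R / 2 <= (wt (row_word k y))%:R) \/
  (exists l, delta * d%:R / 2 <= (wt (col_word l y))%:R).
Proof.
move=> tau2 taud yD yw ytau y0.
have [c [r [/mem_cols_inP cC /mem_rows_inP rD yE ck rl]]] := normal_split taud yD yw ytau.
have [r0|rn0] := eqVneq r 0.
  right; have [l cl] : exists l, col_word l y != 0.
    apply/existsP; apply: contraNT y0; rewrite negb_exists => /forallP h.
    apply/eqP/ffunP => -[k l]; have := h l; rewrite negbK => /eqP/ffunP/(_ k).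
    by rewrite !ffunE.
  exists l; rewrite yE r0 addr0 in cl *.
  apply: (@le_trans _ _ (min_dist C)%:R); last by rewrite ler_nat min_dist_le.
  by apply: le_trans hC; rewrite ler_pdivrMr // ler_peMr ?ler1n // ltW.
left; have [k rk] : exists k, row_word k r != 0.
  apply/existsP; apply: contraNT rn0; rewrite negb_exists => /forallP h.
  apply/eqP/ffunP => -[k l]; have := h k; rewrite negbK => /eqP/ffunP/(_ l).
  by rewrite !ffunE.
exists k; have rkE : row_word k r = row_word k y + row_word k c.
  by rewrite -linearD /= yE addrAC word_addxx add0r.
have : (wt (row_word k r))%:R <= (wt (row_word k y))%:R + (wt (row_word k c))%:R :> R.
  by rewrite -natrD ler_nat rkE leq_wtD.
have : delta * d%:R <= (wt (row_word k r))%:R.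
  by apply: le_trans hD _; rewrite ler_nat min_dist_le.
have := ck k; lra.
Qed.

(* If all but [e] rows and all but [e] columns of [z] are close to [D] and to
   [C], the two resulting approximations of [z] differ by a light word of the
   dual tensor code, and robustness glues them into one tensor codeword. *)
Lemma tensor_approximation z (A B : {set 'I_d}) (e : nat) tau :
    (#|A| <= e)%N -> (#|B| <= e)%N -> (e <= d)%N -> e%:R <= p ->
    2 * e%:R <= delta * d%:R -> 0 <= tau -> 2 * d%:R * tau <= w ->
    e%:R + w / (delta * d%:R / 2) < delta * d%:R ->
    (forall k, k \notin A -> exists2 a, a \in D & (wt (row_word k z + a))%:R <= tau) ->
    (forall l, l \notin B -> exists2 b, b \in C & (wt (col_word l z + b))%:R <= tau) ->
  exists2 t, t \in tensor C D &
    (wt (z + t))%:R <= (e%:R + w / (delta * d%:R / 2)) * d%:R + d%:R * tau.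
Proof.
move=> Ae Be ed ep e2 tau0 tauw ew rows cols.
have [a aP] : exists a : 'I_d -> word 'I_d, forall k,
    a k \in D /\ (k \notin A -> (wt (row_word k z + a k))%:R <= tau).
  apply: (fin_all_exists (P := fun k b => b \in D /\ (k \notin A -> (wt (row_word k z + b))%:R <= tau))) => k.
  by case: (boolP (k \in A)) => [|/rows[b bD bt]]; [exists 0; rewrite mem0v | exists b].
have [b bP] : exists b : 'I_d -> word 'I_d, forall l,
    b l \in C /\ (l \notin B -> (wt (col_word l z + b l))%:R <= tau).
  apply: (fin_all_exists (P := fun l a => a \in C /\ (l \notin B -> (wt (col_word l z + a))%:R <= tau))) => l.
  by case: (boolP (l \in B)) => [|/cols[b' bD bt]]; [exists 0; rewrite mem0v | exists b'].
pose r : word ('I_d * 'I_d) := [ffun kl => a kl.1 kl.2].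
pose c : word ('I_d * 'I_d) := [ffun kl => b kl.2 kl.1].
have rowr k : row_word k r = a k by apply/ffunP => l; rewrite !ffunE.
have colc l : col_word l c = b l by apply/ffunP => k; rewrite !ffunE.
have rD : r \in rows_in 'I_d D by apply/mem_rows_inP => k; rewrite rowr; case: (aP k).
have cC : c \in cols_in 'I_d C by apply/mem_cols_inP => l; rewrite colc; case: (bP l).
have wr k : k \notin A -> (wt (row_word k (z + r)))%:R <= tau.
  by move=> kA; rewrite linearD /= rowr; case: (aP k) => _; apply.
have wc l : l \notin B -> (wt (col_word l (z + c)))%:R <= tau.
  by move=> lB; rewrite linearD /= colc; case: (bP l) => _; apply.
pose m := #|[set ij | [&& (c + r) ij != 0%R, ij.1 \notin A & ij.2 \notin B]]|.
(* Where [c] and [r] differ, [z] differs from one of them, so these entries are charged to at most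
   [d] rows and [d] columns, each with at most [tau]. *)
have mw : m%:R <= w.
  apply: le_trans tauw.
  have : (m <= \sum_(k | k \notin A) wt (row_word k (z + r)%R) +
               \sum_(l | l \notin B) wt (col_word l (z + c)%R))%N.
    rewrite /m -sum1dep_card big_mkcond /=.
    rewrite (eq_bigr (fun kl => nat_of_bool [&& (c + r) (kl.1, kl.2) != 0,
        kl.1 \notin A & kl.2 \notin B])); last first.
      by case=> k l _ /=; case: ifP.
    rewrite -(pair_bigA _ (fun k l => nat_of_bool [&& (c + r) (k, l) != 0, k \notin A & l \notin B])) /=.
    rewrite [X in (_ <= X + _)%N]big_mkcond [X in (_ <= _ + X)%N]big_mkcond /=.
    apply: (@leq_trans (\sum_k \sum_l (((z + r)%R (k, l) != 0%R) && (k \notin A)) +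
                        \sum_l \sum_k (((z + c)%R (k, l) != 0%R) && (l \notin B)))%N).
      rewrite [X in (_ <= _ + X)%N]exchange_big -big_split leq_sum //= => k _.
      rewrite -big_split leq_sum //= => l _.
      case: (k \notin A) => /=; last by rewrite !andbF.
      case: (l \notin B); last by rewrite !andbF.
      rewrite !andbT [(c + r)%R _]ffunE [(z + r)%R _]ffunE [(z + c)%R _]ffunE.
      move: (c (k, l)) (r (k, l)) (z (k, l)) => c1 r1 z1.
      have [/eqP|_] := eqVneq (z1 + r1) 0; last by case: (c1 + r1 != 0).
      by rewrite addF2_eq0 => /eqP ->; rewrite add0n addrC leqnn.
    apply: leq_add; apply: leq_sum => k _; case: ifP => kA.
    - by rewrite wt_sum; apply: leq_sum => l _; rewrite [in leqRHS]ffunE; case: (_ != 0).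
    - by rewrite big1 // => l _; rewrite ?kA andbF.
    - by rewrite wt_sum; apply: leq_sum => l _; rewrite [in leqRHS]ffunE; case: (_ != 0).
    - by rewrite big1 // => l _; rewrite ?kA andbF.
  rewrite -(ler_nat R) => /le_trans; apply; rewrite natrD.
  have half (P : pred 'I_d) (F : 'I_d -> nat) : (forall k, P k -> (F k)%:R <= tau) ->
      (\sum_(k | P k) F k)%:R <= d%:R * tau.
    move=> h; rewrite natr_sum; apply: (@le_trans _ _ (\sum_(k : 'I_d) tau)).
      by rewrite big_mkcond; apply: ler_sum => k _; case: ifP => // /h.
    by rewrite sumr_const card_ord mulr_natl.
  have := half _ _ wr; have := half _ _ wc; lra.
have elt : e%:R < delta * d%:R.
  apply: (@le_lt_trans _ _ (delta * d%:R / 2)); first by rewrite ler_pdivlMr // mulrC.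
  by rewrite ltr_pdivrMr // ltr_pMr // ltr1n.
have eC : (e < min_dist C)%N by rewrite -(ltr_nat R); apply: lt_le_trans hC.
have eD : (e < min_dist D)%N by rewrite -(ltr_nat R); apply: lt_le_trans hD.
have w0 : 0 <= w by apply: le_trans mw.
have [|||||||A' [B' [A'b B'b AA' BB' x0]]] := @robust_punctE R _ _ C D w p e A B (c + r) m rob ep Ae Be;
  rewrite ?card_ord //.
  exact: (memv_add cC rD).
(* At least half of [delta * d%:R] remains as distance after puncturing. *)
have bound (K : code 'I_d) : delta * d%:R <= (min_dist K)%:R -> (e < min_dist K)%N ->
    e%:R + m%:R / (min_dist K - e)%:R <= e%:R + w / (delta * d%:R / 2).
  move=> hK eK; rewrite lerD2l; apply: ler_pM => //.
    by rewrite invr_ge0.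
  rewrite lef_pV2 ?posrE ?divr_gt0 // ?ltr0n ?subn_gt0 // natrB ?(ltnW eK) //; lra.
have {}A'b := le_trans A'b (bound D hD eD); have {}B'b := le_trans B'b (bound C hC eC).
have [|||t [tT tr _]] := @tensor_split _ _ C D c r A' B' cC rD.
- by move=> k l kA lB; apply/eqP; rewrite -addF2_eq0 -(x0 k l) // !ffunE.
- by rewrite -(ltr_nat R); apply: lt_le_trans hC; apply: le_lt_trans ew.
- by rewrite -(ltr_nat R); apply: lt_le_trans hD; apply: le_lt_trans ew.
(* A row in [A'] costs at most [d]; on any other row [t] equals [r], which is within [tau] of
   [z]. *)
exists t => //; rewrite wt_rows natr_sum (bigID (mem A')) /=; apply: lerD.
  apply: (@le_trans _ _ (\sum_(k in A') d%:R)).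
    by apply: ler_sum => k _; rewrite ler_nat -[X in (_ <= X)%N]card_ord max_card.
  by rewrite sumr_const -[_ *+ #|_|]mulr_natl ler_wpM2r.
apply: (@le_trans _ _ (\sum_(k : 'I_d) tau)); last by rewrite sumr_const card_ord mulr_natl.
rewrite big_mkcond; apply: ler_sum => k _; case: ifP => // kA'.
have -> : row_word k (z + t) = row_word k (z + r).
  by apply/ffunP => l; rewrite !ffunE tr // ffunE.
by apply: wr; apply: contra kA'; apply: (subsetP AA').
Qed.

End LocalCodes.

(** * Inequalities behind the choice of a good vertex *)

Section Numerics.
Variable R : realType.
Implicit Types (a b c s t y : R).

(* When the main term [t * b] of the mixing inequality is at most half of the
   left-hand side, the square-root term alone bounds [t]. *)
Lemma absorb_main_term a b c s t : 0 < a -> 2 * b <= a -> 0 <= c -> 0 <= s -> 0 <= t ->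
  t * a <= t * b + c * Num.sqrt (s * t) -> t * a ^+ 2 <= 4 * c ^+ 2 * s.
Proof.
move=> a0 ba c0 s0 t0 h; have [->|tn0] := eqVneq t 0.
  by rewrite mul0r !mulr_ge0 ?sqr_ge0.
have tp : 0 < t by rewrite lt0r tn0.
have y0 := sqrtr_ge0 (s * t); have := sqr_sqrtr (mulr_ge0 s0 t0).
move: (Num.sqrt _) y0 h => y y0 h y2.
have h2 : t * a <= 2 * (c * y) by nra.
have ta0 : 0 <= t * a by rewrite mulr_ge0 // ltW.
have cy0 : 0 <= 2 * (c * y) by rewrite mulr_ge0 // mulr_ge0.
have : (t * a) ^+ 2 <= (2 * (c * y)) ^+ 2 by rewrite lerXn2r.
rewrite exprMn => h3; rewrite -(ler_pM2l tp).
have -> : t * (t * a ^+ 2) = t ^+ 2 * a ^+ 2 by ring.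
by apply: le_trans h3 _; rewrite !exprMn y2 le_eqVlt; apply/orP; left; apply/eqP; ring.
Qed.

(* Throughout, [q] stands for the square root of the degree and [u] for its
   power [eps / 2], so that the robustness threshold is [q ^+ 3 / u] and the
   bound on the puncturing is [q * u ^+ 2]. *)
Variables (q u delta : R).
Hypotheses (delta_gt0 : 0 < delta) (delta_le2 : delta <= 2) (u_ge1 : 1 <= u).
Hypothesis u_large : 2 ^+ 19 <= delta ^+ 3 * u.
Hypothesis q_large : 2 ^+ 13 * (u ^+ 2 + 2 / delta + 1) <= delta ^+ 3 * q.

Let u_gt0 : 0 < u. Proof. exact: lt_le_trans u_ge1. Qed.

Let delta2 : delta ^+ 2 <= 4.
Proof.
have -> : 4 = 2 ^+ 2 :> R by ring.
by rewrite lerXn2r // nnegrE ltW.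
Qed.

Let delta3 : delta ^+ 3 <= 4 * delta.
Proof. by rewrite exprS mulrC ler_wpM2r // ltW. Qed.

Let d_inv : 0 < 2 / delta. Proof. by rewrite divr_gt0. Qed.

Lemma q_gt0 : 0 < q.
Proof.
rewrite -(pmulr_rgt0 _ (exprn_gt0 3 delta_gt0)); apply: lt_le_trans q_large.
have := sqr_ge0 u; have := d_inv; lra.
Qed.

Lemma q_bound : 2 ^+ 11 * (u ^+ 2 + 2 / delta + 1) <= delta * q.
Proof. have := q_gt0; have := delta3; have := q_large; nra. Qed.

(** [N] is the order of the group, [W] the weight of the word; [s], [se], [t] count the nonzero, the
    exceptional and the heavy-line vertices; [H] and [E] total the heavy lines and the exceptional
    neighbours. *)
Lemma selection_numerics (N W s se t H E : R) :
    0 < N -> 0 < s -> 0 <= se -> 0 <= t -> se <= s ->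
    s * (delta * q ^+ 2) <= 2 * W ->
    8 * u ^+ 2 * W <= delta * q * N ->
    se * (delta * q ^+ 3 / (2 * u)) <=
      (q ^+ 2) ^+ 2 * (s * se) / N + 4 * q ^+ 2 * Num.sqrt (s * se) ->
    t * (delta * q ^+ 2 / 2) <=
      2 * (q ^+ 2 * (s * t) / N + 2 * q * Num.sqrt (s * t)) ->
    E <= 2 * (q ^+ 2 * (se * t) / N + 2 * q * Num.sqrt (se * t)) ->
    s - se <= H -> H <= 2 * q ^+ 2 * t ->
  0 < t /\ t * (delta ^+ 2 * q ^+ 2 / 2 ^+ 10) <= H - 2 * q / u ^+ 2 * E.
Proof.
move=> N0 s0 se0 t0 ses sW WN h1 h2 h3 h4 h5.
have q0 := q_gt0; have qb := q_bound; have u2 := exprn_gt0 2 u_gt0.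
have dinv := d_inv.
(* The weight bound makes nonzero vertices sparse, hence the main terms of the mixing inequalities
   small. *)
have sN : 4 * q * u ^+ 2 * s <= N.
  have dq0 : 0 < delta * q by rewrite mulr_gt0.
  rewrite -(ler_pM2l dq0); nra.
have sN' : s / N <= (4 * q * u ^+ 2)^-1.
  by rewrite ler_pdivrMr // mulrC ler_pdivlMr ?mulr_gt0 // mulrC.
have ud : 1 <= delta * u.
  have d4 := delta2.
  have := u_large; rewrite exprS -mulrA [delta ^+ 2 * u]mulrC => hh.
  have du0 : 0 < delta * u by rewrite mulr_gt0.
  have : delta * (u * delta ^+ 2) <= delta * u * 4 by rewrite mulrA ler_wpM2l // ltW.
  lra.
have se_le : se * (delta ^+ 2 * q ^+ 2) <= 2 ^+ 8 * u ^+ 2 * s.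
  have a0 : 0 < delta * q ^+ 3 / (2 * u) by rewrite divr_gt0 ?mulr_gt0 ?exprn_gt0.
  have ba : 2 * ((q ^+ 2) ^+ 2 * (s / N)) <= delta * q ^+ 3 / (2 * u).
    apply: (@le_trans _ _ (2 * ((q ^+ 2) ^+ 2 * (4 * q * u ^+ 2)^-1))).
      by rewrite ler_pM2l // ler_wpM2l // sqr_ge0.
    have -> : 2 * ((q ^+ 2) ^+ 2 * (4 * q * u ^+ 2)^-1) = q ^+ 3 / (2 * u ^+ 2).
      by field; rewrite !gt_eqF.
    rewrite -subr_ge0.
    have -> : delta * q ^+ 3 / (2 * u) - q ^+ 3 / (2 * u ^+ 2) = q ^+ 3 / (2 * u ^+ 2) * (delta * u - 1).
      by field; rewrite !gt_eqF.
    by rewrite mulr_ge0 ?subr_ge0 // divr_ge0 ?mulr_ge0 ?exprn_ge0 // ltW.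
  have c0 : 0 <= 4 * q ^+ 2 by rewrite mulr_ge0 ?sqr_ge0.
  have := absorb_main_term a0 ba c0 (ltW s0) se0.
  have -> : se * ((q ^+ 2) ^+ 2 * (s / N)) = (q ^+ 2) ^+ 2 * (s * se) / N.
    by field; rewrite gt_eqF.
  move/(_ h1) => h.
  have k0 : 0 < q ^+ 4 / (4 * u ^+ 2) by rewrite divr_gt0 ?mulr_gt0 ?exprn_gt0.
  rewrite -(ler_pM2l k0); move: h.
  have -> : se * (delta * q ^+ 3 / (2 * u)) ^+ 2 = q ^+ 4 / (4 * u ^+ 2) * (se * (delta ^+ 2 * q ^+ 2)).
    by field; rewrite gt_eqF.
  have -> // : 4 * (4 * q ^+ 2) ^+ 2 * s = q ^+ 4 / (4 * u ^+ 2) * (2 ^+ 8 * u ^+ 2 * s).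
  by field; rewrite gt_eqF.
have t_le : t * (delta ^+ 2 * q ^+ 2) <= 2 ^+ 8 * s.
  have a0 : 0 < delta * q ^+ 2 / 2 by rewrite divr_gt0 ?mulr_gt0 ?exprn_gt0.
  have ba : 2 * (2 * q ^+ 2 * (s / N)) <= delta * q ^+ 2 / 2.
    apply: (@le_trans _ _ (2 * (2 * q ^+ 2 * (4 * q * u ^+ 2)^-1))).
      by rewrite ler_pM2l // ler_wpM2l // mulr_ge0 // sqr_ge0.
    have -> : 2 * (2 * q ^+ 2 * (4 * q * u ^+ 2)^-1) = q / u ^+ 2 by field; rewrite !gt_eqF.
    rewrite ler_pdivrMr //; have u21 : 1 <= u ^+ 2 by rewrite exprn_ege1.
    have : 2 <= delta * q by lra.
    rewrite expr2 => dq2; nra.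
  have c0 : 0 <= 4 * q by rewrite mulr_ge0 // ltW.
  have := absorb_main_term a0 ba c0 (ltW s0) t0.
  have -> : t * (2 * q ^+ 2 * (s / N)) = 2 * (q ^+ 2 * (s * t) / N) by field; rewrite gt_eqF.
  have h2' : t * (delta * q ^+ 2 / 2) <= 2 * (q ^+ 2 * (s * t) / N) + 4 * q * Num.sqrt (s * t) by lra.
  move/(_ h2') => h.
  have k0 : 0 < q ^+ 2 / 4 by rewrite divr_gt0 ?exprn_gt0.
  rewrite -(ler_pM2l k0); move: h.
  have -> : t * (delta * q ^+ 2 / 2) ^+ 2 = q ^+ 2 / 4 * (t * (delta ^+ 2 * q ^+ 2)) by field.
  have -> // : 4 * (4 * q) ^+ 2 * s = q ^+ 2 / 4 * (2 ^+ 8 * s).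
  by field.
have se_half : 2 * se <= s.
  have dq : 2 ^+ 11 * u ^+ 2 <= delta ^+ 2 * q ^+ 2.
    have l1 : 2 ^+ 11 * u <= delta * q by nra.
    have l0 : 0 <= 2 ^+ 11 * u by rewrite mulr_ge0 ?exprn_ge0 // ltW.
    have r0 : 0 <= delta * q by rewrite mulr_ge0 // ltW.
    have : (2 ^+ 11 * u) ^+ 2 <= (delta * q) ^+ 2 by rewrite lerXn2r.
    rewrite !exprMn; have := sqr_ge0 u; lra.
  have : se * (2 ^+ 11 * u ^+ 2) <= 2 ^+ 8 * u ^+ 2 * s.
    by apply: le_trans se_le; rewrite ler_wpM2l.
  nra.
(* Half of [s] survives in [H]; this lower bound on [t] turns the bound on [se] into one by a
   multiple of [u ^+ 2 * t]. *)
have s_t : s <= 4 * q ^+ 2 * t by lra.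
have t_gt0 : 0 < t.
  have q20 : 0 < 4 * q ^+ 2 by rewrite mulr_gt0 ?exprn_gt0.
  by rewrite -(pmulr_rgt0 _ q20); apply: lt_le_trans s_t.
split=> //.
have sqrt_le : Num.sqrt (se * t) <= 32 * u / delta * t.
  have r0 : 0 <= 32 * u / delta * t by rewrite mulr_ge0 // divr_ge0 ?mulr_ge0 // ltW.
  rewrite -[leRHS](ger0_norm r0) -sqrtr_sqr ler_wsqrtr //.
  have -> : (32 * u / delta * t) ^+ 2 = 2 ^+ 10 * u ^+ 2 / delta ^+ 2 * t * t.
    by field; rewrite gt_eqF.
  rewrite ler_wpM2r //.
  have k0 : 0 < delta ^+ 2 * q ^+ 2 by rewrite mulr_gt0 ?exprn_gt0.
  rewrite -(ler_pM2r k0); apply: le_trans se_le _.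
  have -> : 2 ^+ 10 * u ^+ 2 / delta ^+ 2 * t * (delta ^+ 2 * q ^+ 2) = 2 ^+ 8 * u ^+ 2 * (4 * q ^+ 2 * t).
    by field; rewrite gt_eqF.
  by rewrite ler_wpM2l // mulr_ge0 ?sqr_ge0 ?exprn_ge0.
(* The constant is 2 for the main term plus 128 for the square-root term. *)
have E_le : E <= 130 * q * u / delta * t.
  have m1 : 2 * (q ^+ 2 * (se * t) / N) <= q * t.
    have -> : 2 * (q ^+ 2 * (se * t) / N) = (se / N) * (2 * q ^+ 2 * t) by field; rewrite gt_eqF.
    apply: (@le_trans _ _ ((4 * q * u ^+ 2)^-1 * (2 * q ^+ 2 * t))).
      have k0 : 0 <= 2 * q ^+ 2 * t by rewrite mulr_ge0 // mulr_ge0 ?sqr_ge0.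
      rewrite ler_wpM2r //; apply: le_trans _ sN'.
      by rewrite ler_wpM2r // invr_ge0 ltW.
    have -> : (4 * q * u ^+ 2)^-1 * (2 * q ^+ 2 * t) = q * t / (2 * u ^+ 2) by field; rewrite !gt_eqF.
    have qt0 : 0 < q * t by rewrite mulr_gt0.
    rewrite ler_pdivrMr ?mulr_gt0 // ler_peMr ?(ltW qt0) //.
    have : 1 <= u ^+ 2 by rewrite exprn_ege1.
    lra.
  have m2 : q * t <= 2 * q * u / delta * t.
    have -> : 2 * q * u / delta * t = (q * t) * (2 * u / delta) by ring.
    have l1 : 1 <= 2 * u / delta.
      rewrite ler_pdivlMr // mul1r; have := u_ge1; have := delta_le2; lra.
    by rewrite ler_peMr // mulr_ge0 // ltW.
  have m3 : 2 * (2 * q * Num.sqrt (se * t)) <= 128 * q * u / delta * t.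
    have -> : 128 * q * u / delta * t = 4 * q * (32 * u / delta * t) by ring.
    by rewrite mulrA mulrA -natrM ler_wpM2l // mulr_ge0 // ltW.
  have -> : 130 * q * u / delta * t = 2 * q * u / delta * t + 128 * q * u / delta * t by ring.
  lra.
(* The lower bound on [u] keeps the loss within half of the lower bound
   [t * (delta ^+ 2 * q ^+ 2) / 2 ^+ 9] on [H]. *)
have KE : 2 * q / u ^+ 2 * E <= t * (delta ^+ 2 * q ^+ 2 / 2 ^+ 10).
  have k0 : 0 <= 2 * q / u ^+ 2 by rewrite divr_ge0 ?mulr_ge0 // ltW.
  apply: le_trans (ler_wpM2l k0 E_le) _.
  have -> : 2 * q / u ^+ 2 * (130 * q * u / delta * t) = t * q ^+ 2 * (260 / (delta * u)).
    by field; rewrite !gt_eqF.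
  have -> : t * (delta ^+ 2 * q ^+ 2 / 2 ^+ 10) = t * q ^+ 2 * (delta ^+ 2 / 2 ^+ 10) by ring.
  have tq0 : 0 <= t * q ^+ 2 by rewrite mulr_ge0 ?sqr_ge0.
  apply: ler_wpM2l => //; rewrite ler_pdivrMr ?mulr_gt0 //.
  have -> : delta ^+ 2 / 2 ^+ 10 * (delta * u) = delta ^+ 3 * u / 2 ^+ 10 by ring.
  have := u_large; lra.
have -> : t * (delta ^+ 2 * q ^+ 2 / 2 ^+ 10) = t * (delta ^+ 2 * q ^+ 2) / 2 ^+ 9 - t * (delta ^+ 2 * q ^+ 2 / 2 ^+ 10).
  by field.
apply: lerB => //; rewrite ler_pdivrMr //; lra.
Qed.

End Numerics.

(** * Lowering the weight of a light codeword *)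

Section Reduction.
Variables (R : realType) (gT : finGroupType) (A B : {set gT}) (d : nat).
Variables (al be : 'I_d -> gT) (si ti : 'I_d -> 'I_d).
Hypotheses (AV : (A^-1)%g = A) (BV : (B^-1)%g = B) (tnc : TNC A B).
Hypotheses (al_inj : injective al) (al_im : [set al i | i : 'I_d] = A).
Hypotheses (be_inj : injective be) (be_im : [set be i | i : 'I_d] = B).
Hypotheses (al_si : forall k, al (si k) = (al k)^-1%g).
Hypotheses (be_ti : forall l, be (ti l) = (be l)^-1%g).
Hypotheses (ramA : Ramanujan R d (Cay_left A)) (ramB : Ramanujan R d (Cay_right B)).
Variables (C D : code 'I_d) (delta q u p : R).
Hypotheses (delta_gt0 : 0 < delta) (delta_le2 : delta <= 2) (u_ge1 : 1 <= u).
Hypothesis u_large : 2 ^+ 19 <= delta ^+ 3 * u.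
Hypothesis q_large : 2 ^+ 13 * (u ^+ 2 + 2 / delta + 1) <= delta ^+ 3 * q.
Hypotheses (dE : d%:R = q ^+ 2) (rob : robust_punct (q ^+ 3 / u) p C D).
Hypotheses (p_large : q * u ^+ 2 <= p).
Hypotheses (hC : delta * d%:R <= (min_dist C)%:R) (hD : delta * d%:R <= (min_dist D)%:R).
Variables (i : bool) (x : word (sq A B)).

Let y g := local_view al be (g, i) x.
Let z g := local_view al be (g, ~~ i) x.

Hypothesis yD : forall g, y g \in dual_tensor C D.

(* [Se] is the set of exceptional vertices. A line of a view [z g] counts in
   [h g] when it is heavy and shared with a non-exceptional vertex, while [e g]
   counts the exceptional neighbours of [g]. *)
Let S := [set g | y g != 0].
Let wn := delta * q ^+ 3 / (2 * u).
Let Se := [set g | wn < (wt (y g))%:R].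
Let heavy (v : word 'I_d) := delta * d%:R / 2 <= (wt v)%:R.
Let hrow g := (\sum_k ((al k * g \notin Se)%g && heavy (row_word k (z g))))%N.
Let hcol g := (\sum_l ((g * be l \notin Se)%g && heavy (col_word l (z g))))%N.
Let h g := (hrow g + hcol g)%N.
Let e g := (\sum_k (al k * g \in Se)%g + \sum_l (g * be l \in Se)%g)%N.
Let T := [set g | (0 < h g)%N].

Let q0 : 0 < q. Proof. exact: (q_gt0 delta_gt0 q_large). Qed.
Let u0 : 0 < u. Proof. exact: lt_le_trans u_ge1. Qed.
Let d_gt0 : (0 < d)%N. Proof. by rewrite -(ltr0n R) dE exprn_gt0. Qed.
Let dd0 : 0 < delta * d%:R. Proof. by rewrite mulr_gt0 ?ltr0n. Qed.
Let qb := q_bound delta_gt0 delta_le2 q_large.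

Let view_row g k : row_word (si k) (y (al k * g)%g) = row_word k (z g).
Proof.
apply/ffunP => l; rewrite [LHS]ffunE [RHS]ffunE.
by have := view_left al_im be_im al_si g (~~ i) x k l; rewrite negbK.
Qed.

Let view_col g l : col_word (ti l) (y (g * be l)%g) = col_word l (z g).
Proof.
apply/ffunP => k; rewrite [LHS]ffunE [RHS]ffunE.
by have := view_right al_im be_im al_si be_ti g (~~ i) x k l; rewrite negbK.
Qed.

(** The largest value that [tensor_approximation] allows for the robustness threshold; [wn] is
    [delta * d%:R * tau]. *)
Let tau := q / (2 * u).

Let tau_ge0 : 0 <= tau.
Proof. by rewrite divr_ge0 ?mulr_ge0 // ltW. Qed.

Let dq_large : 2 ^+ 11 <= delta * q.
Proof.
apply: le_trans qb; have : 0 < 2 / delta by rewrite divr_gt0.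
have := sqr_ge0 u; lra.
Qed.

Let tau_small : 2 * tau <= delta * d%:R.
Proof.
apply: (@le_trans _ _ q).
  have -> : 2 * tau = q / u by rewrite /tau; field; rewrite gt_eqF.
  by rewrite ler_pdivrMr // ler_peMr // ltW.
rewrite dE expr2 mulrA ler_peMl //; first exact: ltW.
apply: le_trans dq_large; lra.
Qed.

Let tau_lt : tau < delta * d%:R.
Proof. have := tau_small; have := dd0; have := tau_ge0; lra. Qed.

Let tauE : 2 * d%:R * tau = q ^+ 3 / u.
Proof. by rewrite dE /tau; field; rewrite gt_eqF. Qed.

Let wn_le : wn <= q ^+ 3 / u.
Proof.
have -> : wn = q ^+ 3 / u * (delta / 2) by rewrite /wn; field; rewrite gt_eqF.
rewrite ler_piMr ?divr_ge0 ?exprn_ge0 ?(ltW q0) ?(ltW u0) //.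
by rewrite ler_pdivrMr // mul1r.
Qed.

Let normal g : g \notin Se -> (wt (y g))%:R <= q ^+ 3 / u /\ (wt (y g))%:R / (delta * d%:R) <= tau.
Proof.
rewrite inE -leNgt => h1; split; first exact: le_trans wn_le.
rewrite ler_pdivrMr // dE.
have -> // : tau * (delta * q ^+ 2) = wn.
by rewrite /tau /wn; field; rewrite gt_eqF.
Qed.

Let p_ge0 : 0 <= p.
Proof. by apply: le_trans p_large; rewrite mulr_ge0 ?sqr_ge0 // ltW. Qed.

Let dd_le_w : delta * d%:R <= q ^+ 3 / u.
Proof.
rewrite dE ler_pdivlMr //.
have -> : delta * q ^+ 2 * u = delta * u * q ^+ 2 by ring.
rewrite [leRHS]exprS; apply: ler_wpM2r; first exact: sqr_ge0.
have u2 : u <= u ^+ 2 by rewrite expr2 ler_peMl // ltW.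
have dinv : 0 < 2 / delta by rewrite divr_gt0.
have : delta * u <= 2 * u by rewrite ler_wpM2r // ltW.
have : delta * q <= 2 * q by rewrite ler_wpM2r // ltW.
have := qb; have := u0; lra.
Qed.

Let wt_le_views : #|S|%:R * (delta * q ^+ 2) <= 2 * (wt x)%:R.
Proof.
rewrite -natrM -(sum_wt_view tnc al_inj al_im be_inj be_im al_si be_ti i) natr_sum.
rewrite -dE mulr_natl -sumr_const [leLHS]big_mkcond; apply: ler_sum => g _.
case: ifP => // gS; apply: (dual_tensor_wt rob p_ge0 delta_gt0 hC hD d_gt0 dd_le_w (yD g)).
by rewrite inE in gS.
Qed.

(** A nonzero entry at [g] is also an entry of the view at the opposite corner of its square, which
    thus lies in [S]; an exceptional vertex has more than [wn] such corners. *)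
Let exceptional_mixing :
  #|Se|%:R * wn <= (q ^+ 2) ^+ 2 * (#|S|%:R * #|Se|%:R) / #|gT|%:R +
    4 * q ^+ 2 * Num.sqrt (#|S|%:R * #|Se|%:R).
Proof.
rewrite -dE.
apply: le_trans (mixing_square AV BV al_inj al_im be_inj be_im ramA ramB S Se).
rewrite mulr_natl -sumr_const; apply: ler_sum => g; rewrite inE => /ltW; move/le_trans; apply.
rewrite wt_sum natr_sum; apply: ler_sum => -[k l] _ /=; rewrite ler_nat.
have [//|ykl] := eqVneq (y g (k, l)) 0; rewrite inE.
suff -> : y (al k * g * be l)%g != 0 by [].
apply: contraNneq ykl => e0.
have e1 : y (al k * g * be l)%g (si k, ti l) = y g (k, l).
  have := view_right al_im be_im al_si be_ti (al k * g)%g (~~ i) x (si k) l.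
  by rewrite (view_left al_im be_im al_si) negbK.
by rewrite -e1 e0 ffunE.
Qed.

Let heavy_row_nbrs g k : heavy (row_word k (z g)) ->
  delta * q ^+ 2 / 2 <= \sum_l (g * be l \in S)%g%:R.
Proof.
rewrite /heavy dE => /le_trans; apply.
rewrite wt_sum natr_sum; apply: ler_sum => l _; rewrite ler_nat ffunE inE.
have [//|zkl] := eqVneq (z g (k, l)) 0.
suff -> : y (g * be l)%g != 0 by [].
apply: contraNneq zkl => e0; have := view_col g l.
by rewrite e0 => /ffunP/(_ k); rewrite !ffunE => <-.
Qed.

Let heavy_col_nbrs g l : heavy (col_word l (z g)) ->
  delta * q ^+ 2 / 2 <= \sum_k (al k * g \in S)%g%:R.
Proof.
rewrite /heavy dE => /le_trans; apply.
rewrite wt_sum natr_sum; apply: ler_sum => k _; rewrite ler_nat ffunE inE.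
have [//|zkl] := eqVneq (z g (k, l)) 0.
suff -> : y (al k * g)%g != 0 by [].
apply: contraNneq zkl => e0; have := view_row g k.
by rewrite e0 => /ffunP/(_ l); rewrite !ffunE => <-.
Qed.

Let mixing_lr (S1 U : {set gT}) :
  \sum_(g in U) (\sum_k (al k * g \in S1)%g%:R + \sum_l (g * be l \in S1)%g%:R) <=
  2 * (q ^+ 2 * (#|S1|%:R * #|U|%:R) / #|gT|%:R + 2 * q * Num.sqrt (#|S1|%:R * #|U|%:R)) :> R.
Proof.
have sq : Num.sqrt d%:R = q by rewrite dE sqrtr_sqr ger0_norm // ltW.
rewrite big_split /= [leRHS]mulrDl mul1r -[q in 2 * q]sq -dE.
apply: lerD; first exact: (mixing_left AV al_inj al_im ramA).
exact: (mixing_right BV be_inj be_im ramB).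
Qed.

Let heavy_mixing :
  #|T|%:R * (delta * q ^+ 2 / 2) <=
    2 * (q ^+ 2 * (#|S|%:R * #|T|%:R) / #|gT|%:R + 2 * q * Num.sqrt (#|S|%:R * #|T|%:R)).
Proof.
apply: le_trans (mixing_lr S T); rewrite mulr_natl -sumr_const; apply: ler_sum => g.
rewrite inE /h addn_gt0 => /orP[]; rewrite lt0n sum_nat_eq0 negb_forall => /existsP[k];
  rewrite eqb0 negbK => /andP[_ hk].
  by apply: le_trans (heavy_row_nbrs hk) _; rewrite lerDr sumr_ge0.
by apply: le_trans (heavy_col_nbrs hk) _; rewrite lerDl sumr_ge0.
Qed.

Let e_mixing :
  (\sum_(g in T) e g)%:R <=
    2 * (q ^+ 2 * (#|Se|%:R * #|T|%:R) / #|gT|%:R + 2 * q * Num.sqrt (#|Se|%:R * #|T|%:R)) :> R.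
Proof.
apply: le_trans (mixing_lr Se T); rewrite natr_sum; apply: ler_sum => g _.
by rewrite natrD !natr_sum.
Qed.

Let h_le g : (h g <= 2 * d)%N.
Proof.
have b (F : 'I_d -> bool) : (\sum_k F k <= d)%N.
  by rewrite -[leqRHS]card_ord -sum1_card leq_sum // => k _; case: (F k).
by rewrite mul2n -addnn; apply: leq_add; apply: b.
Qed.

Let sum_h_T : (\sum_(g in T) h g = \sum_g h g)%N.
Proof.
rewrite [LHS]big_mkcond; apply: eq_bigr => g _; rewrite inE.
by case: posnP.
Qed.

(** A line of [z g] is a line of a neighbouring view [y], so after reindexing along edges the total
    counts heavy lines of non-exceptional views, and each nonzero one has such a line by
    [heavy_line]. *)
Let S_le_h : (#|S| - #|Se| <= \sum_g h g)%N.
Proof.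
have -> : (\sum_g h g = \sum_g (g \notin Se) *
    (\sum_k heavy (row_word k (y g)) + \sum_l heavy (col_word l (y g))))%N.
  rewrite big_split /=.
  have -> : (\sum_g hrow g = \sum_g \sum_k ((g \notin Se) && heavy (row_word k (y g))))%N.
    rewrite exchange_big [RHS]exchange_big /= [RHS](reindex_inj (inv_inj (siK al_inj al_si))).
    apply: eq_bigr => k _; rewrite [RHS](reindex_inj (mulgI (al k))).
    by apply: eq_bigr => g _; rewrite view_row.
  have -> : (\sum_g hcol g = \sum_g \sum_l ((g \notin Se) && heavy (col_word l (y g))))%N.
    rewrite exchange_big [RHS]exchange_big /= [RHS](reindex_inj (inv_inj (tiK be_inj be_ti))).
    apply: eq_bigr => l _; rewrite [RHS](reindex_inj (mulIg (be l))).
    by apply: eq_bigr => g _; rewrite view_col.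
  rewrite -big_split; apply: eq_bigr => g _ /=; case: (g \notin Se); first by rewrite mul1n.
  by rewrite mul0n /= !big1.
apply: (@leq_trans #|S :\: Se|).
  by rewrite cardsD leq_sub2l // subset_leq_card // subsetIr.
rewrite -sum1_card [leqLHS]big_mkcond leq_sum // => g _; case: ifP => //.
rewrite in_setD => /andP[gSe]; rewrite inE gSe mul1n => y0.
have [w1 w2] := normal gSe.
have [[k hk]|[l hl]] := heavy_line rob p_ge0 delta_gt0 hC hD d_gt0 tau_small tau_lt (yD g) w1 w2 y0.
  by rewrite (bigD1 k) //= [heavy _]hk.
by rewrite [X in (_ + X)%N](bigD1 l) //= [heavy _]hl addnCA.
Qed.

Hypotheses (x_neq0 : x != 0).
Hypothesis wt_x : 8 * u ^+ 2 * (wt x)%:R <= delta * q * #|gT|%:R.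

Let S_gt0 : 0 < #|S|%:R :> R.
Proof.
rewrite ltr0n card_gt0; apply: contra x_neq0 => /eqP S0.
rewrite -wt_eq0 -[_ == _](eqn_pmul2l (isT : (0 < 2)%N)).
rewrite -(sum_wt_view tnc al_inj al_im be_inj be_im al_si be_ti i) muln0 sum_nat_eq0.
apply/forallP => g; apply/implyP => _; rewrite wt_eq0.
by have := in_set0 g; rewrite -S0 inE => /negbFE.
Qed.

(* Averaging [h g - (2 * q / u ^+ 2) * e g] over [T]. *)
Let good_vertex : exists g, delta ^+ 2 * q ^+ 2 / 2 ^+ 10 <= (h g)%:R - 2 * q / u ^+ 2 * (e g)%:R.
Proof.
have N0 : 0 < #|gT|%:R :> R by rewrite ltr0n; apply/card_gt0P; exists 1%g.
have SeS : #|Se|%:R <= #|S|%:R :> R.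
  rewrite ler_nat subset_leq_card //; apply/subsetP => g; rewrite !inE => wg.
  apply: contraTneq wg => ->; rewrite -leNgt (_ : wt 0 = 0%N); last by apply/eqP; rewrite wt_eq0.
  by rewrite divr_ge0 ?mulr_ge0 ?exprn_ge0 ?(ltW q0) ?(ltW u0) ?(ltW delta_gt0).
have H1 : #|S|%:R - #|Se|%:R <= (\sum_(g in T) h g)%:R :> R.
  by rewrite lerBlDl -natrD ler_nat -leq_subLR sum_h_T.
have H2 : (\sum_(g in T) h g)%:R <= 2 * q ^+ 2 * #|T|%:R.
  rewrite -dE -!natrM ler_nat [leqRHS]mulnC -sum_nat_const.
  by apply: leq_sum => g _; apply: h_le.
have [T0 sum_ge] := selection_numerics delta_gt0 delta_le2 u_ge1 u_large q_large N0 S_gt0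
  (ler0n _ _) (ler0n _ _) SeS wt_le_views wt_x exceptional_mixing heavy_mixing e_mixing H1 H2.
pose f g := (h g)%:R - 2 * q / u ^+ 2 * (e g)%:R.
have [/existsP[g hg]|/existsPn no] := boolP [exists g, delta ^+ 2 * q ^+ 2 / 2 ^+ 10 <= f g].
  by exists g.
suff : \sum_(g in T) f g < \sum_(g in T) (delta ^+ 2 * q ^+ 2 / 2 ^+ 10).
  suff : \sum_(g in T) (delta ^+ 2 * q ^+ 2 / 2 ^+ 10) <= \sum_(g in T) f g by rewrite ltNge => ->.
  by rewrite sumr_const -[_ *+ #|T|]mulr_natl sumrB -mulr_sumr
    -[X in _ <= X - _]natr_sum -[X in _ <= _ - _ * X]natr_sum.
apply: ltr_sum; last by move=> g _; rewrite ltNge no.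
rewrite ltr0n in T0; have /card_gt0P[g gT'] := T0.
by apply/hasP; exists g => //; apply: mem_index_enum.
Qed.

(** As [h g] is at most twice the degree, the factor [2 * q / u ^+ 2] is tuned to yield exactly the
    puncturing bound. *)
Let e_small g : (h g)%:R - 2 * q / u ^+ 2 * (e g)%:R >= 0 -> (e g)%:R <= q * u ^+ 2.
Proof.
move=> ge0; have K0 : 0 < 2 * q / u ^+ 2 by rewrite divr_gt0 ?mulr_gt0 ?exprn_gt0.
rewrite -(ler_pM2l K0); apply: (@le_trans _ _ (h g)%:R); first by rewrite -subr_ge0.
have -> : 2 * q / u ^+ 2 * (q * u ^+ 2) = 2 * q ^+ 2 by field; rewrite gt_eqF.
by rewrite -dE -natrM ler_nat h_le.
Qed.

(** Rows and columns are summed separately, so an entry is counted at most twice. *)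
Let h_wt g : (h g)%:R * (delta * q ^+ 2 / 2) <= 2 * (wt (z g))%:R.
Proof.
have b (P : pred 'I_d) (F : 'I_d -> word 'I_d) :
    (\sum_k (P k && heavy (F k)))%N%:R * (delta * q ^+ 2 / 2) <= (\sum_k wt (F k))%N%:R.
  rewrite !natr_sum mulr_suml; apply: ler_sum => k _; rewrite /heavy dE.
  case: (P k) => /=; last by rewrite mul0r.
  by have [hk|_] := boolP (delta * q ^+ 2 / 2 <= (wt (F k))%:R); rewrite ?mul1r ?mul0r.
rewrite natrD mulrDl mulrDl mul1r; apply: lerD.
  by rewrite [wt _]wt_rows; apply: b.
by rewrite [wt _]wt_cols; apply: b.
Qed.

(** At a good vertex the many heavy lines give a weight of order [q ^+ 4], and the few exceptional
    neighbours permit [tensor_approximation], whose error has order [q ^+ 3 * u ^+ 2] only. *)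
Lemma reduction_step : exists g, exists2 t, t \in tensor C D &
  (wt (z g + t)%R < wt (z g))%N.
Proof.
have [g hg] := good_vertex.
have c0 : 0 <= delta ^+ 2 * q ^+ 2 / 2 ^+ 10 by apply: divr_ge0; [apply: mulr_ge0; exact: sqr_ge0 | exact: exprn_ge0].
have eq := e_small (le_trans c0 hg).
have hge : delta ^+ 2 * q ^+ 2 / 2 ^+ 10 <= (h g)%:R.
  apply: le_trans hg _; rewrite lerBlDr lerDl mulr_ge0 // divr_ge0 ?sqr_ge0 // mulr_ge0 //.
  exact: ltW.
have dinv : 0 < 2 / delta by rewrite divr_gt0.
have wE : q ^+ 3 / u / (delta * d%:R / 2) = q * (2 / delta) / u.
  by rewrite dE; field; rewrite !gt_eqF.
have w_le : q ^+ 3 / u / (delta * d%:R / 2) <= q * (2 / delta).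
  by rewrite wE ler_pdivrMr // ler_peMr // mulr_ge0 // ltW.
have qu2 : 2 ^+ 11 * (q * u ^+ 2 + q * (2 / delta) + q) <= delta * d%:R.
  rewrite dE; have -> : delta * q ^+ 2 = q * (delta * q) by ring.
  have -> : 2 ^+ 11 * (q * u ^+ 2 + q * (2 / delta) + q) = q * (2 ^+ 11 * (u ^+ 2 + 2 / delta + 1)) by ring.
  by rewrite ler_wpM2l // ltW.
have qd0 : 0 < q * (2 / delta) by rewrite mulr_gt0.
have qu0 : 0 < q * u ^+ 2 by rewrite mulr_gt0 ?exprn_gt0.
have e2 : 2 * (e g)%:R <= delta * d%:R by have := q0; lra.
pose Ae := [set k | (al k * g)%g \in Se]; pose Be := [set l | (g * be l)%g \in Se].
have Aee : (#|Ae| <= e g)%N.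
  apply: leq_trans (leq_addr _ _); rewrite -sum1_card big_mkcond leq_sum // => k _.
  by rewrite inE; case: (_ \in Se).
have Bee : (#|Be| <= e g)%N.
  apply: leq_trans (leq_addl _ _); rewrite -sum1_card big_mkcond leq_sum // => k _.
  by rewrite inE; case: (_ \in Se).
have ed : (e g <= d)%N.
  rewrite -(ler_nat R) -(ler_pM2l (ltr0Sn R 1)); apply: le_trans e2 _.
  by rewrite ler_wpM2r.
have ep : (e g)%:R <= p := le_trans eq p_large.
have tw : 2 * d%:R * tau <= q ^+ 3 / u by rewrite tauE.
have ew : (e g)%:R + q ^+ 3 / u / (delta * d%:R / 2) < delta * d%:R by have := q0; lra.
(* The row is shared with a non-exceptional view, whose row part is in [D] and whose column part is
   light on every row. *)
have rows k : k \notin Ae -> exists2 a, a \in D & (wt (row_word k (z g) + a))%:R <= tau.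
  rewrite inE => /normal[w1 w2].
  have [c [r [_ /mem_rows_inP rD yE ct _]]] :=
    normal_split rob p_ge0 delta_gt0 hC hD d_gt0 tau_lt (yD _) w1 w2.
  exists (row_word (si k) r) => //; rewrite -view_row yE linearD /= -addrA word_addxx addr0.
  exact: ct.
have cols l : l \notin Be -> exists2 b, b \in C & (wt (col_word l (z g) + b))%:R <= tau.
  rewrite inE => /normal[w1 w2].
  have [c [r [/mem_cols_inP cC _ yE _ rt]]] :=
    normal_split rob p_ge0 delta_gt0 hC hD d_gt0 tau_lt (yD _) w1 w2.
  exists (col_word (ti l) c) => //; rewrite -view_col yE linearD /= addrAC word_addxx add0r.
  exact: rt.
have [t tT tz] := tensor_approximation rob delta_gt0 hC hD d_gt0 Aee Bee ed ep e2 tau_ge0 tw ew rows cols.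
exists g, t => //; rewrite -(ltr_nat R); apply: le_lt_trans tz _.
have tau_le : tau <= q.
  by rewrite ler_pdivrMr ?mulr_gt0 // ler_peMr ?(ltW q0) //; have := u_ge1; lra.
apply: (@le_lt_trans _ _ ((q * u ^+ 2 + q * (2 / delta) + q) * d%:R)).
  rewrite [d%:R * tau]mulrC -mulrDl ler_wpM2r //; lra.
have large : delta ^+ 3 * (q ^+ 2) ^+ 2 / 2 ^+ 12 <= (wt (z g))%:R.
  have hw := h_wt g; rewrite -(ler_pM2l (ltr0Sn R 1)); apply: le_trans hw.
  have -> : 2 * (delta ^+ 3 * (q ^+ 2) ^+ 2 / 2 ^+ 12) = delta ^+ 2 * q ^+ 2 / 2 ^+ 10 * (delta * q ^+ 2 / 2) by field.
  by rewrite ler_wpM2r // divr_ge0 // mulr_ge0 ?sqr_ge0 // ltW.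
apply: lt_le_trans large.
(* [q_large] keeps the error within half of the lower bound on the weight. *)
apply: (@le_lt_trans _ _ (delta ^+ 3 * (q ^+ 2) ^+ 2 / 2 ^+ 13)).
  rewrite dE ler_pdivlMr ?exprn_gt0 //.
  have -> : (q * u ^+ 2 + q * (2 / delta) + q) * q ^+ 2 * 2 ^+ 13 = q ^+ 3 * (2 ^+ 13 * (u ^+ 2 + 2 / delta + 1)) by ring.
  have -> : delta ^+ 3 * (q ^+ 2) ^+ 2 = q ^+ 3 * (delta ^+ 3 * q) by ring.
  by rewrite ler_wpM2l // exprn_ge0 // ltW.
have X0 : 0 < delta ^+ 3 * (q ^+ 2) ^+ 2 by rewrite mulr_gt0 // !exprn_gt0.
by rewrite ltr_pM2l // ltf_pV2 ?posrE ?exprn_gt0 // ltr_eXn2l // ltr1n.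
Qed.

End Reduction.

(** * Dimension and distance *)

Section TannerCodes.
Variables (gT : finGroupType) (A B : {set gT}) (d : nat).
Variables (al be : 'I_d -> gT) (si ti : 'I_d -> 'I_d).
Hypotheses (AV : (A^-1)%g = A) (BV : (B^-1)%g = B) (tnc : TNC A B).
Hypotheses (al_inj : injective al) (al_im : [set al i | i : 'I_d] = A).
Hypotheses (be_inj : injective be) (be_im : [set be i | i : 'I_d] = B).
Hypotheses (al_si : forall k, al (si k) = (al k)^-1%g).
Hypotheses (be_ti : forall l, be (ti l) = (be l)^-1%g).

Lemma mem_TannerP i (K : code ('I_d * 'I_d)) (x : word (sq A B)) :
  reflect (forall g, local_view al be (g, i) x \in K) (x \in Tanner A B al be i K).
Proof.
apply: (iffP subv_bigcapP) => [h g|h g _].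
  by have := h g isT; rewrite -memvE -memv_preim lfunE.
by rewrite -memvE -memv_preim lfunE; apply: h.
Qed.

Lemma dim_Tanner_ge i (K : code ('I_d * 'I_d)) :
  (#|squares A B| <= \dim (Tanner A B al be i (dual K)) + #|gT| * \dim K)%N.
Proof.
have <- : \dim {: word (sq A B)} = #|squares A B|.
  by rewrite dim_word card_sig; apply: eq_card.
apply: dimv_bigcap_ge => g.
have := dim_preim_ge (linfun (local_view (A := A) (B := B) al be (g, i))) (dual K).
rewrite dim_dual [\dim {: word ('I_d * 'I_d)}]dim_word.
have : (\dim K <= #|{: 'I_d * 'I_d}|)%N by rewrite -dim_word dimvS ?subvf.
move: (\dim K) (\dim (_ @^-1: _)) (\dim {: word (sq A B)}) #|{: 'I_d * 'I_d}| => a b c e; lia.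
Qed.

(** Both sides impose at most [\dim CA * (d - \dim CA)] constraints per vertex, since duality
    exchanges the two dimensions. *)
Lemma css_dim_ge (CA CB : code 'I_d) : \dim CB = (d - \dim CA)%N ->
  #|squares A B|%:Z - (2 * #|gT| * (\dim CA * (d - \dim CA)))%N%:Z <=
    css_dim (code0 A B al be CA CB) (code1 A B al be CA CB).
Proof.
move=> dB; have dimA : (\dim CA <= d)%N by rewrite -[leqRHS]card_ord -dim_word dimvS ?subvf.
have arith (a b t1 t2 m s N : nat) : (s <= a + N * t1)%N -> (s <= b + N * t2)%N ->
    (t1 <= m)%N -> (t2 <= m)%N -> s%:Z - (2 * N * m)%N%:Z <= a%:Z + b%:Z - s%:Z.
  move=> h1 h2 h3 h4.
  have : (N * t1 <= N * m)%N by rewrite leq_mul2l h3 orbT.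
  have : (N * t2 <= N * m)%N by rewrite leq_mul2l h4 orbT.
  lia.
rewrite /css_dim (_ : #|{: sq A B}| = #|squares A B|); last by rewrite card_sig; apply: eq_card.
apply: (arith _ _ _ _ _ _ _ (dim_Tanner_ge false (tensor CA CB))
  (dim_Tanner_ge true (tensor (dual CA) (dual CB)))).
  by rewrite -dB; apply: dim_tensor.
apply: leq_trans (dim_tensor _ _) _.
by rewrite !dim_dual !card_ord dB subKn // mulnC.
Qed.

Variables (R : realType) (delta q u p : R).
Hypotheses (ramA : Ramanujan R d (Cay_left A)) (ramB : Ramanujan R d (Cay_right B)).
Hypotheses (delta_gt0 : 0 < delta) (delta_le2 : delta <= 2) (u_ge1 : 1 <= u).
Hypothesis u_large : 2 ^+ 19 <= delta ^+ 3 * u.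
Hypothesis q_large : 2 ^+ 13 * (u ^+ 2 + 2 / delta + 1) <= delta ^+ 3 * q.
Hypotheses (dE : d%:R = q ^+ 2) (p_large : q * u ^+ 2 <= p).

(** Induction on the weight: adding the embedded codeword of [reduction_step] lowers it, and
    [embed_dual_tensor] keeps the views in the dual tensor code. *)
Lemma light_word_dual_Tanner (C D : code 'I_d) (i : bool) (x : word (sq A B)) :
    robust_punct (q ^+ 3 / u) p C D ->
    delta * d%:R <= (min_dist C)%:R -> delta * d%:R <= (min_dist D)%:R ->
    (forall g, local_view al be (g, i) x \in dual_tensor C D) ->
    8 * u ^+ 2 * (wt x)%:R <= delta * q * #|gT|%:R ->
  x \in dual (Tanner A B al be (~~ i) (dual (tensor C D))).
Proof.
move=> rob hC hD; have [m] := ubnP (wt x); elim: m x => // m IHm x xm xCD wx.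
have [->|x0] := eqVneq x 0; first exact: mem0v.
have [g [t tCD zt]] := reduction_step AV BV tnc al_inj al_im be_inj be_im al_si be_ti
  ramA ramB delta_gt0 delta_le2 u_ge1 u_large q_large dE rob p_large hC hD xCD x0 wx.
have wt_lt := wt_add_embed tnc al_inj al_im be_inj be_im al_si be_ti zt.
set w := embed _ _ _ _ _ _ in wt_lt.
have {IHm}xw : x + w \in dual (Tanner A B al be (~~ i) (dual (tensor C D))).
  apply: IHm.
  - by apply: leq_trans wt_lt _; rewrite -ltnS.
  - move=> h; rewrite linearD /=; apply: (memvD (xCD h)).
    have := embed_dual_tensor tnc al_inj al_im be_inj be_im al_si be_ti g h (~~ i) tCD.
    by rewrite negbK.
  - apply: le_trans wx; apply: ler_wpM2l; last by rewrite ler_nat ltnW.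
    by rewrite mulr_ge0 // sqr_ge0.
(* The product of a word with an embedded [t] is that of its view at [g] with [t]. *)
have wT : w \in dual (Tanner A B al be (~~ i) (dual (tensor C D))).
  apply/mem_dualP => v /mem_TannerP/(_ g)/mem_dualP vt.
  by rewrite dotpC dotp_embed vt.
have -> : x = (x + w) + w by rewrite -addrA word_addxx addr0.
exact: (memvD xw wT).
Qed.

End TannerCodes.

(** * Large degrees and the final bounds *)

Lemma powR_nat_large (R : realType) (c M : R) : 0 < c ->
  exists n0 : nat, forall n, (n0 <= n)%N -> M <= n%:R `^ c.
Proof.
move=> c0; pose x := Num.max M 0 `^ c^-1.
exists (Num.bound x) => n hn.
have x0 : 0 <= x := powR_ge0 _ _.
have xn : x <= n%:R.
  apply: le_trans (_ : (Num.bound x)%:R <= _); last by rewrite ler_nat.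
  by apply: le_trans (ltW (archi_boundP x0)).
apply: le_trans (_ : x `^ c <= _); last by rewrite ge0_ler_powR ?nnegrE // ltW.
rewrite /x -powRrM mulVf ?gt_eqF // powRr1; first by rewrite le_max lexx.
by rewrite le_max lexx orbT.
Qed.

Theorem theorem17 (R : realType) (rho eps gamma delta : R)
    (hrho : 0 < rho < 1 / 2) (heps : 0 < eps < 1 / 2)
    (hgamma : 1 / 2 + eps < gamma < 1) (hdelta : 0 < delta) :
  exists Delta0 : nat, forall Delta : nat, (Delta0 <= Delta)%N ->
  forall CA CB : code 'I_Delta,
    (0 < \dim CA)%N -> (\dim CA)%:R <= rho * Delta%:R ->
    (\dim CB = Delta - \dim CA)%N ->
    delta * Delta%:R <= (min_dist CA)%:R ->
    delta * Delta%:R <= (min_dist CB)%:R ->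
    delta * Delta%:R <= (min_dist (dual CA))%:R ->
    delta * Delta%:R <= (min_dist (dual CB))%:R ->
    robust_punct (Delta%:R `^ (3 / 2 - eps / 2)) (Delta%:R `^ gamma)
      (dual CA) (dual CB) ->
    robust_punct (Delta%:R `^ (3 / 2 - eps / 2)) (Delta%:R `^ gamma) CA CB ->
  forall (gT : finGroupType) (A B : {set gT}),
    (A^-1)%g = A -> (B^-1)%g = B -> #|A| = Delta -> #|B| = Delta ->
    TNC A B ->
    Ramanujan R Delta (Cay_left A) -> Ramanujan R Delta (Cay_right B) ->
  forall alpha beta : 'I_Delta -> gT,
    injective alpha -> [set alpha i | i : 'I_Delta] = A ->
    injective beta -> [set beta i | i : 'I_Delta] = B ->
  let C0 := code0 A B alpha beta CA CB in
  let C1 := code1 A B alpha beta CA CB in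
  let n := #|squares A B| in
  (1 - 2 * rho) ^+ 2 * n%:R <= (css_dim C0 C1)%:~R /\
  delta / (4 * Delta%:R `^ (3 / 2 + eps)) * n%:R <= (css_dist C0 C1)%:R.
Proof.
have [rho0 rho1] := andP hrho; have [eps0 eps1] := andP heps; have [gam0 gam1] := andP hgamma.
(* [M * u ^+ 2 <= q] implies the largeness condition on [q]; it holds eventually because
   [q / u ^+ 2] is the degree to the power [1 / 2 - eps]. *)
pose M := 2 ^+ 13 * (2 + 2 / delta) / delta ^+ 3.
have eps20 : 0 < eps / 2 by rewrite divr_gt0.
have epsc : 0 < 1 / 2 - eps by rewrite subr_gt0.
have [n1 hn1] := powR_nat_large (2 ^+ 19 / delta ^+ 3) eps20.
have [n2 hn2] := powR_nat_large M epsc.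
exists (maxn 1 (maxn n1 n2)) => Delta; rewrite !geq_max => /and3P[D1 Dn1 Dn2].
move=> CA CB A_gt0 Arho dB hA hB hAd hBd robd rob gT A B AV BV cA cB tnc ramA ramB
  al be al_inj al_im be_inj be_im C0 C1 n.
have [si al_si] := inverse_index AV al_im; have [ti be_ti] := inverse_index BV be_im.
pose q : R := Num.sqrt Delta%:R; pose u : R := Delta%:R `^ (eps / 2).
have D1R : 1 <= Delta%:R :> R by rewrite ler1n.
have D0R : 0 < Delta%:R :> R by rewrite ltr0n.
have dE : Delta%:R = q ^+ 2 by rewrite sqr_sqrtr ?ler0n.
have qE : q = Delta%:R `^ (1 / 2) by rewrite mul1r powR12_sqrt ?ler0n.
have q_gt0 : 0 < q by rewrite sqrtr_gt0.
have u_ge1 : 1 <= u by rewrite -(powRr0 Delta%:R) ler_powR // ltW.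
have u_gt0 : 0 < u := lt_le_trans ltr01 u_ge1.
have powE a b c : a + b = c -> Delta%:R `^ a * Delta%:R `^ b = Delta%:R `^ c :> R.
  by move=> <-; rewrite powRD // (lt0r_neq0 D0R) implybT.
have qXE k : q ^+ k = Delta%:R `^ (k%:R / 2).
  by rewrite qE -powR_mulrn ?powR_ge0 // -powRrM mulrC mulrA mulr1.
have uXE : u ^+ 2 = Delta%:R `^ eps.
  by rewrite -powR_mulrn ?powR_ge0 // -powRrM divfK ?pnatr_eq0.
have wE : Delta%:R `^ (3 / 2 - eps / 2) = q ^+ 3 / u.
  apply: (mulIf (lt0r_neq0 u_gt0)); rewrite divfK ?gt_eqF // qXE.
  by apply: powE; rewrite subrK.
have bE : Delta%:R `^ (3 / 2 + eps) = q ^+ 3 * u ^+ 2.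
  by rewrite qXE uXE; apply/esym/powE.
(* The lower bound on [gamma] makes the resistance cover all exceptional neighbours of a good
   vertex. *)
have p_large : q * u ^+ 2 <= Delta%:R `^ gamma.
  by rewrite qE uXE (powE _ _ _ erefl) ler_powR // ltW.
have d3 : 0 < delta ^+ 3 by rewrite exprn_gt0.
have dinv : 0 < 2 / delta by rewrite divr_gt0.
(* A distance is at most the length plus one, the default of an empty minimum, hence at most
   [2 * Delta]. *)
have delta_le2 : delta <= 2.
  rewrite -(ler_pM2r D0R); apply: le_trans hA _.
  apply: (@le_trans _ _ Delta.+1%:R).
    by rewrite ler_nat; apply: leq_trans (min_dist_leS _) _; rewrite card_ord.
  by rewrite -natrM ler_nat mul2n -addnn -addn1 leq_add2l.
have u_large : 2 ^+ 19 <= delta ^+ 3 * u.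
  by have := hn1 _ Dn1; rewrite ler_pdivrMr // mulrC.
have q_large : 2 ^+ 13 * (u ^+ 2 + 2 / delta + 1) <= delta ^+ 3 * q.
  have u21 : 1 <= u ^+ 2 by rewrite exprn_ege1.
  have Mq : M * u ^+ 2 <= q.
    rewrite qE -(powE (1 / 2 - eps) eps) ?subrK // uXE ler_wpM2r ?powR_ge0 //.
    exact: hn2.
  apply: le_trans (_ : delta ^+ 3 * (M * u ^+ 2) <= _); last by rewrite ler_wpM2l // ltW.
  have -> : delta ^+ 3 * (M * u ^+ 2) = 2 ^+ 13 * ((2 + 2 / delta) * u ^+ 2).
    by rewrite /M; field; rewrite !gt_eqF.
  rewrite ler_pM2l ?exprn_gt0 //.
  have : 2 / delta <= 2 / delta * u ^+ 2 by rewrite ler_peMr // ltW.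
  clear -u21; lra.
rewrite wE in rob robd; rewrite bE.
have nE : 2 * n%:R = #|gT|%:R * (q ^+ 2) ^+ 2 :> R.
  rewrite -dE -natrX -!natrM; congr _%:R.
  exact: (card_squares tnc al_inj al_im be_inj be_im al_si be_ti).
split.
  have := css_dim_ge A B al be dB.
  rewrite -/C0 -/C1 -/n -(ler_int R) => /(le_trans _); apply.
  have dimA : (\dim CA <= Delta)%N.
    by rewrite -[leqRHS]card_ord -dim_word dimvS ?subvf.
  rewrite intrB -!pmulrn !natrM natrB // dE.
  set a : R := (\dim CA)%:R; rewrite dE in Arho.
  have -> : 2 * #|gT|%:R * (a * (q ^+ 2 - a)) = n%:R * (4 * a * (q ^+ 2 - a)) / (q ^+ 2) ^+ 2.
    have -> : n%:R = #|gT|%:R * (q ^+ 2) ^+ 2 / 2 by rewrite -nE; field.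
    by field; rewrite gt_eqF.
  set Q := q ^+ 2 in Arho *; have Q0 : 0 < Q by rewrite exprn_gt0.
  rewrite -subr_ge0.
  (* Completing the square leaves only [(1 - 2 * rho) * Q <= Q - 2 * a] to check. *)
  have -> : n%:R - n%:R * (4 * a * (Q - a)) / Q ^+ 2 - (1 - 2 * rho) ^+ 2 * n%:R =
      n%:R / Q ^+ 2 * ((Q - 2 * a) ^+ 2 - ((1 - 2 * rho) * Q) ^+ 2).
    by field; rewrite gt_eqF.
  apply: mulr_ge0; first by rewrite divr_ge0 ?sqr_ge0.
  have r0 : 0 <= (1 - 2 * rho) * Q by rewrite mulr_ge0 ?(ltW Q0) //; clear -rho1; lra.
  have le : (1 - 2 * rho) * Q <= Q - 2 * a by clear -Arho; lra.
  by rewrite subr_ge0 lerXn2r // nnegrE //; apply: le_trans le.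
have qu0 : 0 < q ^+ 3 * u ^+ 2 by rewrite mulr_gt0 // exprn_gt0.
have n0 : 0 <= n%:R :> R by rewrite ler0n.
have light (x : word (sq A B)) : (wt x)%:R < delta / (4 * (q ^+ 3 * u ^+ 2)) * n%:R ->
    8 * u ^+ 2 * (wt x)%:R <= delta * q * #|gT|%:R.
  move=> wx; have k0 : 0 < 8 * u ^+ 2 by rewrite mulr_gt0 // exprn_gt0.
  have := ltW wx; rewrite -(ler_pM2l k0) => /le_trans; apply.
  have -> : n%:R = #|gT|%:R * (q ^+ 2) ^+ 2 / 2 by rewrite -nE; field.
  by rewrite le_eqVlt; apply/orP; left; apply/eqP; field; rewrite !gt_eqF.
rewrite /css_dist /min_weight; elim/big_ind: _ => [|a b ha hb|x].
(* The default value of the minimum must respect the bound too; the factor of [n] is at most 1 as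
   [delta <= 2]. *)
- have -> : #|{: sq A B}| = n by rewrite card_sig; apply: eq_card.
  apply: (@le_trans _ _ n%:R); last by rewrite ler_nat.
  rewrite ler_piMl // ler_pdivrMr ?mulr_gt0 // mul1r.
  have q1 : 1 <= q by rewrite -sqrtr1 ler_wsqrtr.
  have : 1 <= q ^+ 3 * u ^+ 2 by rewrite mulr_ege1 // exprn_ege1.
  clear -delta_le2; lra.
- by rewrite /minn; case: ifP.
rewrite inE leNgt => xP; apply/negP => /light wx; move: xP.
have mem_dual_tensor CA' CB' i : x \in Tanner A B al be i (dual (tensor CA' CB')) ->
    forall g, local_view al be (g, i) x \in dual_tensor (dual CA') (dual CB').
  move=> /mem_TannerP h g; apply: (subvP (dual_tensor_dual _ _)).
  by rewrite !dualK; apply: h.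
have light_dual := light_word_dual_Tanner AV BV tnc al_inj al_im be_inj be_im al_si be_ti
  ramA ramB hdelta delta_le2 u_ge1 u_large q_large dE p_large.
(* A light word of either code lies in the dual of the other; side [false] uses robustness of the
   dual codes, side [true] that of [CA] and [CB]. *)
case/orP => /andP[xC /negP]; apply.
  exact: (light_dual _ _ false x robd hAd hBd (mem_dual_tensor _ _ _ xC) wx).
have := mem_dual_tensor _ _ _ xC; rewrite !dualK => xC'.
exact: (light_dual _ _ true x rob hA hB xC' wx).
Qed.
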